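(* Let $M$ be an oriented non-degenerate hypersurface in the Minkowski space $\mathbb{E}^{n+1}_1$ with position vector $x$, such that the tangential part $x^T$ of $x$ is nowhere zero and nowhere light-like. Let $e_1=\dfrac{x^T}{(\varepsilon\langle x^T,x^T\rangle)^{1/2}}$ be the unit tangent vector field along $x^T$, where $\varepsilon\in\{1,-1\}$ is the sign of $\langle x^T,x^T\rangle$. Then $M$ is a GCR hypersurface if and only if every integral curve of $e_1$ is a geodesic of $M$.
   Context: $\mathbb{E}^{n+1}_1$ is $\mathbb{R}^{n+1}$ with the metric $\langle\ ,\ \rangle=-dx_1^2+\sum_{j=2}^{n+1}dx_j^2$. A hypersurface is non-degenerate if its induced metric is non-degenerate. With unit normal $N$ and flat connection $\widetilde\nabla$ of $\mathbb{E}^{n+1}_1$, the shape operator $S$ is given by $\widetilde\nabla_XN=-S(X)$; principal directions are eigenvectors of $S$. The position vector decomposes as $x=x^T+x^\perp$ into tangential and normal parts along $M$. $M$ is a generalized constant ratio (GCR) hypersurface if $x^T$ is a principal direction of $M$. Geodesics are with respect to the Levi-Civita connection of the induced metric. *)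

(* Defs.v *)
From mathcomp Require Import all_boot all_order all_algebra.
From mathcomp Require Import all_classical all_reals all_analysis.

Set Implicit Arguments.
Unset Strict Implicit.
Unset Printing Implicit Defensive.

Import Order.TTheory GRing.Theory Num.Theory numFieldNormedType.Exports.

Local Open Scope classical_set_scope.
Local Open Scope ring_scope.

Section Smooth.
Variables (R : realType) (V W : normedModType R).

(* [U] is meant to be open. *)
Fixpoint Ck_on (k : nat) (U : set V) (f : V -> W) : Prop :=
  match k with
  | 0 => forall a, U a -> {for a, continuous f}
  | k'.+1 => (forall a, U a -> differentiable f a) /\
             (forall v, Ck_on k' U (fun a => 'D_v f a))
  end.

Definition smooth_on (U : set V) (f : V -> W) := forall k, Ck_on k U f.

End Smooth.

(* A smooth [n]-manifold structure on [M].  The chart [chart i] is a total     *)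
(* function, meaningful on [chart_dom i] only, and [param i] is its inverse,   *)
(* meaningful on the open set [chart i @` chart_dom i].                        *)
Record smooth_manifold (R : realType) (n : nat) (M : topologicalType) := {
  chart_idx : Type;
  chart_dom : chart_idx -> set M;
  chart : chart_idx -> M -> 'rV[R]_n;
  param : chart_idx -> 'rV[R]_n -> M;
  manifold_hausdorff : hausdorff_space M;
  manifold_second_countable : @second_countable M;
  chart_cover : forall p, exists i, chart_dom i p;
  chart_dom_open : forall i, open (chart_dom i);
  chart_img_open : forall i, open (chart i @` chart_dom i);
  chartK : forall i p, chart_dom i p -> param i (chart i p) = p;
  chart_continuous : forall i p,
    chart_dom i p -> {for p, continuous (chart i)};
  param_continuous : forall i u,
    (chart i @` chart_dom i) u -> {for u, continuous (param i)};
  transition_smooth : forall i j,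
    smooth_on (chart i @` (chart_dom i `&` chart_dom j)) (chart j \o param i)
}.

Arguments chart_dom {R n M s} i.
Arguments chart {R n M s} i.
Arguments param {R n M s} i.

Definition chart_img (R : realType) n (M : topologicalType)
  (A : smooth_manifold R n M) (i : chart_idx A) := chart i @` chart_dom i.

(* The inner product of Minkowski space, coordinate 0 being the time-like one. *)
Definition mink (R : realType) n (v w : 'rV[R]_n.+1) : R :=
  - (v 0 ord0 * w 0 ord0) + \sum_(j < n) v 0 (lift ord0 j) * w 0 (lift ord0 j).

Definition lightlike (R : realType) n (v : 'rV[R]_n.+1) : Prop :=
  v != 0 /\ mink v v = 0.

(* An immersed hypersurface; the orientation is the choice of a smooth global  *)
(* unit normal field.                                                          *)
Record oriented_hypersurface (R : realType) n (M : topologicalType)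
    (A : smooth_manifold R n M) := {
  position : M -> 'rV[R]_n.+1;
  normal : M -> 'rV[R]_n.+1;
  position_smooth : forall i : chart_idx A,
    smooth_on (chart_img i) (position \o param i);
  position_immersion : forall (i : chart_idx A) u v, chart_img i u ->
    'D_v (position \o param i) u = 0 -> v = 0;
  normal_smooth : forall i : chart_idx A,
    smooth_on (chart_img i) (normal \o param i);
  normal_unit : forall p, mink (normal p) (normal p) = 1 \/
                          mink (normal p) (normal p) = -1;
  normal_orthogonal : forall (i : chart_idx A) u v, chart_img i u ->
    mink (normal (param i u)) ('D_v (position \o param i) u) = 0
}.

Section Hypersurface.
Variables (R : realType) (n : nat) (M : topologicalType).
Variables (A : smooth_manifold R n M) (H : oriented_hypersurface A).

Local Notation x := (position H).
Local Notation N := (normal H).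

(* The induced metric on coordinate vectors, in the chart [i]. *)
Definition induced_metric (i : chart_idx A) (u v w : 'rV[R]_n) : R :=
  mink ('D_v (x \o param i) u) ('D_w (x \o param i) u).

Definition nondegenerate_hypersurface := forall (i : chart_idx A) u v, chart_img i u ->
  (forall w, induced_metric i u v w = 0) -> v = 0.

Definition metric_coef (i : chart_idx A) (u : 'rV[R]_n) : 'M[R]_n :=
  \matrix_(a, b) induced_metric i u (delta_mx 0 a) (delta_mx 0 b).

(* Christoffel symbols of the Levi-Civita connection of the induced metric. *)
Definition christoffel (i : chart_idx A) (u : 'rV[R]_n) (k a b : 'I_n) : R :=
  let dg c d e := 'D_(delta_mx 0 c) (fun u' => metric_coef i u' d e : R) u in
  2^-1 * \sum_l invmx (metric_coef i u) k l * (dg a b l + dg b a l - dg l a b).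

(* Tangent vectors of [M] at [p] are identified with their images under the    *)
(* differential of the position vector.  [dir_derivative F p w z] says that    *)
(* [w] is tangent to [M] at [p] and that [z] is the derivative along [w], for  *)
(* the flat connection of the ambient space, of the field [F] along [M].       *)
Definition dir_derivative (F : M -> 'rV[R]_n.+1) (p : M) (w z : 'rV[R]_n.+1) :=
  exists (i : chart_idx A) (v : 'rV[R]_n),
    [/\ chart_dom i p, w = 'D_v (x \o param i) (chart i p)
      & z = 'D_v (F \o param i) (chart i p)].

(* The graph of the shape operator at [p]. *)
Definition shape_operator (p : M) (w z : 'rV[R]_n.+1) :=
  dir_derivative N p w (- z).

Definition principal_direction (p : M) (w : 'rV[R]_n.+1) :=
  w != 0 /\ exists k : R, shape_operator p w (k *: w).

Definition normal_part (p : M) : 'rV[R]_n.+1 :=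
  (mink (x p) (N p) / mink (N p) (N p)) *: N p.

Definition tangential_part (p : M) : 'rV[R]_n.+1 := x p - normal_part p.

Definition GCR := forall p, principal_direction p (tangential_part p).

Definition unit_tangential (p : M) : 'rV[R]_n.+1 :=
  let q := mink (tangential_part p) (tangential_part p) in
  (Num.sqrt (Num.sg q * q))^-1 *: tangential_part p.

(* Curves are total functions, considered on an open interval [J] only. *)

(* [E] is a tangent vector field, given by its ambient values. *)
Definition integral_curve (E : M -> 'rV[R]_n.+1) (J : set R) (gamma : R -> M) :=
  forall t, J t -> {for t, continuous gamma} /\
    forall i : chart_idx A, chart_dom i (gamma t) ->
      let c : R -> 'rV[R]_n := chart i \o gamma in
      derivable c t 1 /\ 'D_(derive1 c t) (x \o param i) (c t) = E (gamma t).

(* The geodesic equation; smoothness of the solutions is automatic. *)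
Definition geodesic (J : set R) (gamma : R -> M) :=
  forall t, J t -> {for t, continuous gamma} /\
    forall i : chart_idx A, chart_dom i (gamma t) ->
      let c : R -> 'rV[R]_n := chart i \o gamma in
      [/\ derivable c t 1, derivable (derive1 c) t 1 &
        forall k, derive1n 2 c t 0 k + \sum_a \sum_b
          christoffel i (c t) k a b * derive1 c t 0 a * derive1 c t 0 b = 0].

End Hypersurface.

(* Main.v *)
Require Import Defs.
From mathcomp Require Import all_boot all_order all_algebra.
From mathcomp Require Import all_classical all_reals all_analysis.
From mathcomp Require Import ring lra.
Import Order.TTheory GRing.Theory Num.Theory numFieldNormedType.Exports.
Local Open Scope classical_set_scope.
Local Open Scope ring_scope.

Set Implicit Arguments.
Unset Strict Implicit.
Unset Printing Implicit Defensive.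

(* Write x = h^-1 e_1 + mu N.  Differentiating along a tangent vector w and    *)
(* taking w = e_1 gives                                                        *)
(*   <D_{e_1} e_1, w> = b <x^T, w> - h mu <D_{e_1} N, w>   for all w tangent,  *)
(* and <D_{e_1} e_1, e_1> = 0.  If D_{e_1} N is parallel to x^T, then          *)
(* D_{e_1} e_1 has no tangential part, which is the geodesic equation.         *)
(* Conversely, if all integral curves of e_1 are geodesics, D_{e_1} N is       *)
(* parallel to x^T wherever mu <> 0.  Being transverse to x^T is an open       *)
(* condition, so at a point where D_{e_1} N is not parallel to x^T the         *)
(* function mu vanishes on a neighbourhood; then 0 = w <x, N> = <x^T, D_w N>   *)
(* for all w, and by symmetry of the shape operator D_{e_1} N = 0 there,       *)
(* a contradiction.  The converse uses the existence of integral curves, hence *)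
(* the Picard-Lindelof theorem.                                                *)

(** * Continuously differentiable functions *)

(** In a chart with parametrization [X], the field e_1 is the derivative of [X] along a coordinate
    field [V] ([unit_coord]). There GCR says that [normal_rate], the derivative of N along e_1, is a
    multiple of e_1 ([normal_rate_of_principal], [principal_of_normal_rate]). Along an integral
    curve the velocity is [V], so the geodesic equation reads nabla_V V = 0. By the Gauss formula
    this means that [unit_accel], the flat derivative of e_1 along itself, is orthogonal to the
    tangent space ([integral_curve_geodesic_coef], [geodesic_coefP]).

    The two pointwise conditions are compared through [mink_accel]. For [geodesic_of_principal] the
    extra ingredient is that <e_1, e_1> has derivative zero; for [principal_of_geodesic] it is the
    symmetry of the shape operator ([shape_symmetric]), which handles open sets where x is tangent
    to M. To pass from curves back to points, [integral_curve_exists] puts an integral curve through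
    every point: [V] is C1, hence locally Lipschitz ([C1_lipschitz]), and [picard_lindelof]
    applies. *)

Section C1_functions.
Variables (R : realType) (V : normedModType R) (U : set V).
Hypothesis openU : open U.
Implicit Types f g : V -> R.

Lemma C1_cst (c : R) : Ck_on 1 U (fun=> c : R).
Proof.
split=> [a _|v a _]; first exact: differentiable_cst.
have -> : 'D_v (fun=> c : R) = cst 0 :> (V -> R).
  by apply/funext => b; exact: derive_cst.
exact: cst_continuous.
Qed.

Lemma C1_continuous f a : Ck_on 1 U f -> U a -> {for a, continuous f}.
Proof. by move=> [df _] Ua; exact/differentiable_continuous/df. Qed.

(* [df] is given everywhere but agrees with the derivative on [U] only. *)
Lemma C1_eq_on f (df : V -> V -> R) :
    (forall a, U a -> differentiable f a) ->
    (forall v a, U a -> 'D_v f a = df v a) ->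
    (forall v a, U a -> {for a, continuous (df v)}) ->
  Ck_on 1 U f.
Proof.
move=> diff_f dfE cdf; split=> // v a Ua.
rewrite /prop_for /continuous_at /= dfE//; apply: cvg_trans (cdf v a Ua).
apply: near_eq_cvg; near=> b; rewrite dfE//.
by near: b; exact: open_nbhs_nbhs.
Unshelve. all: by end_near. Qed.

Lemma C1_add f g : Ck_on 1 U f -> Ck_on 1 U g -> Ck_on 1 U (fun a => f a + g a).
Proof.
move=> [df cf] [dg cg].
apply: (@C1_eq_on _ (fun v a => 'D_v f a + 'D_v g a)) => [a Ua|v a Ua|v a Ua].
- by apply: differentiableD; [exact: df|exact: dg].
- by rewrite (@deriveD _ _ _ f g)//; apply: diff_derivable; [exact: df|exact: dg].
- by apply: continuousD; [exact: cf|exact: cg].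
Qed.

Lemma C1_mul f g : Ck_on 1 U f -> Ck_on 1 U g -> Ck_on 1 U (fun a => f a * g a).
Proof.
move=> C1f C1g; move: (C1f) (C1g) => [df cf] [dg cg].
apply: (@C1_eq_on _ (fun v a => f a * 'D_v g a + g a * 'D_v f a))
  => [a Ua|v a Ua|v a Ua].
- by apply: differentiableM; [exact: df|exact: dg].
- by rewrite (@deriveM _ _ f g)//; apply: diff_derivable; [exact: df|exact: dg].
- apply: continuousD; (apply: continuousM; first exact: C1_continuous).
    exact: cg.
  exact: cf.
Qed.

Lemma C1_opp f : Ck_on 1 U f -> Ck_on 1 U (fun a => - f a).
Proof.
move=> C1f; have -> : (fun a => - f a) = (fun a => -1 * f a).
  by apply/funext => a; rewrite mulN1r.
exact: (C1_mul (C1_cst (-1)) C1f).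
Qed.

Lemma C1_sum (I : Type) (r : seq I) (P : pred I) (F : I -> V -> R) :
    (forall i, P i -> Ck_on 1 U (F i)) ->
  Ck_on 1 U (fun a => \sum_(i <- r | P i) F i a).
Proof.
move=> C1F; elim: r => [|i r IHr].
  have -> : (fun a => \sum_(i <- [::] | P i) F i a) = fun=> 0.
    by apply/funext => a; rewrite big_nil.
  exact: C1_cst.
have -> : (fun a => \sum_(j <- i :: r | P j) F j a) =
    fun a => if P i then F i a + \sum_(j <- r | P j) F j a
             else \sum_(j <- r | P j) F j a.
  by apply/funext => a; rewrite big_cons.
case: (boolP (P i)) => [Pi|_]; [exact: (C1_add (C1F i Pi) IHr)|exact: IHr].
Qed.

Lemma C1_prod (I : Type) (r : seq I) (P : pred I) (F : I -> V -> R) :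
    (forall i, P i -> Ck_on 1 U (F i)) ->
  Ck_on 1 U (fun a => \prod_(i <- r | P i) F i a).
Proof.
move=> C1F; elim: r => [|i r IHr].
  have -> : (fun a => \prod_(i <- [::] | P i) F i a) = fun=> 1.
    by apply/funext => a; rewrite big_nil.
  exact: C1_cst.
have -> : (fun a => \prod_(j <- i :: r | P j) F j a) =
    fun a => if P i then F i a * \prod_(j <- r | P j) F j a
             else \prod_(j <- r | P j) F j a.
  by apply/funext => a; rewrite big_cons.
case: (boolP (P i)) => [Pi|_]; [exact: (C1_mul (C1F i Pi) IHr)|exact: IHr].
Qed.

Lemma C1_comp (g g' : R -> R) f : Ck_on 1 U f ->
    (forall a, U a -> is_derive (f a) 1 g (g' (f a))) ->
    (forall a, U a -> {for f a, continuous g'}) ->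
  Ck_on 1 U (fun a => g (f a)).
Proof.
move=> C1f dg cg; have [df cf] := C1f.
have diffg a : U a -> differentiable g (f a).
  by move=> Ua; apply/derivable1_diffP; have [] := dg _ Ua.
apply: (@C1_eq_on _ (fun v a => g' (f a) * 'D_v f a)) => [a Ua|v a Ua|v a Ua].
- by apply: (@differentiable_comp _ _ _ _ f g); [exact: df|exact: diffg].
- have dfa := df _ Ua; rewrite [LHS](@deriveE _ _ _ (g \o f)); last first.
    by apply: differentiable_comp => //; exact: diffg.
  rewrite diff_comp//; last exact: diffg.
  rewrite /= deriveE// -[X in 'd g _ X = _]mulr1 [LHS]linearZ/= mulrC.
  congr (_ * _); rewrite -deriveE; last exact: diffg.
  by have [_] := dg _ Ua.
- apply: continuousM; last exact: cf.
  by apply: (@continuous_comp _ _ _ f g'); [exact: C1_continuous|exact: cg].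
Qed.

Lemma C1_inv f : Ck_on 1 U f -> (forall a, U a -> f a != 0) ->
  Ck_on 1 U (fun a => (f a)^-1).
Proof.
move=> C1f f0; apply: (@C1_comp (fun x => x^-1) (fun x => - x ^- 2)) => // a Ua.
- split; first by apply: derivableV => //; exact: f0.
  by rewrite deriveV// ?derive_id ?scale1r//; [rewrite [LHS]mulr1|exact: f0].
- apply: continuousN; apply: continuousV; first by rewrite expf_neq0// f0.
  exact: exprn_continuous.
Qed.

Lemma C1_sqrt f : Ck_on 1 U f -> (forall a, U a -> 0 < f a) ->
  Ck_on 1 U (fun a => Num.sqrt (f a)).
Proof.
move=> C1f f0; apply: (@C1_comp Num.sqrt (fun x => (2 * Num.sqrt x)^-1)) => // a Ua.
- exact/is_derive1_sqrt/f0.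
- apply: continuousV; first by rewrite mulf_neq0// gt_eqF// sqrtr_gt0 f0.
  apply: continuousM; first exact: cst_continuous.
  exact: sqrt_continuous.
Qed.

Lemma C1_coord m n (F : V -> 'M[R]_(m, n)) i j : Ck_on 1 U F ->
  Ck_on 1 U (fun a => F a i j).
Proof.
move=> [dF cF].
apply: (@C1_eq_on _ (fun v a => ('D_v F a) i j)) => [a Ua|v a Ua|v a Ua].
- apply: (@differentiable_comp _ _ _ _ F (fun M : 'M[R]_(m, n) => M i j)).
    exact: dF.
  exact: differentiable_coord.
- by rewrite derive_mx ?mxE//; exact/diff_derivable/dF.
- apply: (@continuous_comp _ _ _ ('D_v F) (fun M : 'M[R]_(m, n) => M i j)).
    exact: cF.
  exact: coord_continuous.
Qed.

Lemma C1_det n (F : V -> 'M[R]_n) : (forall i j, Ck_on 1 U (fun a => F a i j)) ->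
  Ck_on 1 U (fun a => \det (F a)).
Proof.
move=> C1F; rewrite /determinant; apply: C1_sum => s _.
by apply: C1_mul; [exact: C1_cst|apply: C1_prod].
Qed.

Lemma C1_adjugate n (F : V -> 'M[R]_n) i j :
    (forall i j, Ck_on 1 U (fun a => F a i j)) ->
  Ck_on 1 U (fun a => (\adj (F a)) i j).
Proof.
move=> C1F; under eq_fun do rewrite mxE.
apply: C1_mul; first exact: C1_cst.
by apply: C1_det => k l; under eq_fun do rewrite !mxE; exact: C1F.
Qed.

End C1_functions.

(** * Mixed derivatives and local Lipschitz bounds *)

Section derivatives.
Variables (R : realType) (V W : normedModType R).

Lemma is_derive_line (f : V -> W) (b d : V) (t : R) (l : W) :
  is_derive (b + t *: d) d f l -> is_derive t 1 (fun s => f (b + s *: d)) l.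
Proof.
have quotE : (fun h : R => h^-1 *: (((fun s => f (b + s *: d)) \o shift t) (h *: 1)
                                   - f (b + t *: d)))
    = (fun h => h^-1 *: ((f \o shift (b + t *: d)) (h *: d) - f (b + t *: d))).
  apply/funext => h; congr (_ *: (f _ - _)).
  by rewrite /= [h *: 1]mulr1 scalerDl addrCA.
by move=> [df <-]; split; rewrite /derivable /derive/= quotE.
Qed.

Lemma is_derive_curve (f : V -> W) (c : R -> V) (t : R) (l : V) :
    is_derive t 1 c l -> differentiable f (c t) ->
  is_derive t 1 (f \o c) ('D_l f (c t)).
Proof.
move=> [/derivable1_diffP dc <-] df.
have dfc : differentiable (f \o c) t by exact: differentiable_comp.
split; first exact/derivable1_diffP.
by rewrite deriveE// diff_comp//= deriveE// deriveE.
Qed.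

Lemma derive_comp (V' : normedModType R) (g : V' -> V) (f : V -> W) a v :
    differentiable g a -> differentiable f (g a) ->
  'D_v (f \o g) a = 'D_('D_v g a) f (g a).
Proof.
move=> dg df; rewrite deriveE; last exact: differentiable_comp.
by rewrite diff_comp//= deriveE// deriveE.
Qed.

Lemma derive_scaler (f : V -> W) (a v : V) (k : R) : differentiable f a ->
  'D_(k *: v) f a = k *: 'D_v f a.
Proof. by move=> df; rewrite deriveE// linearZ/= -deriveE. Qed.

Lemma derive_subr (f : V -> W) (a v w : V) : differentiable f a ->
  'D_(v - w) f a = 'D_v f a - 'D_w f a.
Proof. by move=> df; rewrite deriveE// linearB/= -!deriveE. Qed.

Lemma is_derive_translate (f : V -> W) (a b v : V) (l : W) :
  is_derive (a + b) v f l -> is_derive a v (fun x => f (x + b)) l.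
Proof.
have quotE : (fun h : R => h^-1 *: (((fun x => f (x + b)) \o shift a) (h *: v)
                                   - f (a + b)))
    = (fun h => h^-1 *: ((f \o shift (a + b)) (h *: v) - f (a + b))).
  by apply/funext => h; rewrite /= addrA.
by move=> [df <-]; split; rewrite /derivable /derive/= quotE.
Qed.

End derivatives.

Section mixed_derivatives.
Variables (R : realType) (V : normedModType R).

Lemma MVT_line (f : V -> R) (df : V -> R) (b d : V) (s : R) : 0 < s ->
    (forall x, 0 <= x <= s -> is_derive (b + x *: d) d f (df (b + x *: d))) ->
  exists2 x, 0 <= x <= s & f (b + s *: d) - f b = s * df (b + x *: d).
Proof.
move=> s0 dfd.
have dline x : 0 <= x <= s ->
    is_derive x 1 (fun x => f (b + x *: d)) (df (b + x *: d)).
  by move=> xs; apply: is_derive_line; exact: dfd.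
have cline : {within `[0, s], continuous (fun x => f (b + x *: d))}.
  by apply: derivable_within_continuous => x /[!in_itv]/= /dline[].
have dline' x : x \in `]0, s[%R ->
    is_derive x 1 (fun x => f (b + x *: d)) (df (b + x *: d)).
  by rewrite in_itv/= => /andP[x0 xs]; apply: dline; rewrite !ltW.
have [x xI E] := MVT_segment (ltW s0) dline' cline.
exists x; first by move: xI; rewrite in_itv.
by move: E; rewrite scale0r addr0 subr0 mulrC.
Qed.

(* Both mixed derivatives are limits of the same second difference. *)
Lemma derive_commute (U : set V) (u v w : V) (f fv fw fvw fwv : V -> R) :
    open U -> U u ->
    (forall a, U a -> is_derive a v f (fv a)) ->
    (forall a, U a -> is_derive a w f (fw a)) ->
    (forall a, U a -> is_derive a w fv (fvw a)) ->
    (forall a, U a -> is_derive a v fw (fwv a)) ->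
    {for u, continuous fvw} -> {for u, continuous fwv} ->
  fvw u = fwv u.
Proof.
move=> oU Uu dv dw dvw dwv cvw cwv; apply/eqP; rewrite -subr_eq0 -normr_le0.
apply/ler_addgt0Pl => e e0; rewrite addr0.
have e20 : 0 < e / 2 by rewrite divr_gt0.
have [r r0 rP] : exists2 r, 0 < r & forall a : V, `|u - a| <= r ->
    [/\ U a, `|fvw u - fvw a| < e / 2 & `|fwv u - fwv a| < e / 2].
  have : \forall a \near u,
      [/\ U a, `|fvw u - fvw a| < e / 2 & `|fwv u - fwv a| < e / 2].
    near=> a; split; near: a.
    - exact: open_nbhs_nbhs.
    - by move/cvgrPdist_lt : cvw; exact.
    - by move/cvgrPdist_lt : cwv; exact.
  (* The radius is halved to pass from an open ball to a closed one. *)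
  move=> /nbhs_ballP[r /= r0 rP]; exists (r / 2); first by rewrite divr_gt0.
  move=> a ua; apply: rP; rewrite -ball_normE /=; apply: le_lt_trans ua _.
  by rewrite ltr_pdivrMr// ltr_pMr// ltr1n.
pose N := `|v| + `|w| + 1; have N0 : 0 < N by rewrite ltr_wpDl ?addr_ge0.
(* With this side length the whole parallelogram spanned by [s *: v] and [s *: w] at [u] stays
   within distance [r] of [u]. *)
pose s := r / N; have s0 : 0 < s by rewrite divr_gt0.
have near_u x y : 0 <= x <= s -> 0 <= y <= s -> `|u - (u + x *: v + y *: w)| <= r.
  move=> /andP[x0 xs] /andP[y0 ys].
  rewrite -[u + _ + _]addrA opprD addrA subrr sub0r normrN.
  rewrite (le_trans (ler_normD _ _))// !normrZ.
  rewrite !ger0_norm// (@le_trans _ _ (s * `|v| + s * `|w|))//.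
    by rewrite lerD// ler_wpM2r.
  rewrite -mulrDr /s mulrAC ler_pdivrMr// ler_wpM2l ?(ltW r0)//.
  by rewrite lerDl.
have s_in : 0 <= s <= s by rewrite lexx ltW.
have o_in : 0 <= (0 : R) <= s by rewrite lexx ltW.
(* The mean value theorem applied to this second difference, along [v] and then [w], gives s^2 times
   a value of [fvw]; in the other order it gives s^2 times a value of [fwv]. *)
pose D := f (u + s *: v + s *: w) - f (u + s *: v) - f (u + s *: w) + f u.
have [p [_ p1 _] pE] : exists2 p, [/\ U p, `|fvw u - fvw p| < e / 2 &
    `|fwv u - fwv p| < e / 2] & D = s * (s * fvw p).
  pose g a := f (a + s *: w) - f a.
  have [|x xs gE] := @MVT_line g (fun a => fv (a + s *: w) - fv a) u v s s0.
    move=> x xs; apply: is_deriveB.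
      by apply: is_derive_translate; apply: dv; have [] := rP _ (near_u x s xs s_in).
    by apply: dv; have [] := rP _ (near_u x 0 xs o_in); rewrite scale0r addr0.
  have [|y ys yE] := @MVT_line fv fvw (u + x *: v) w s s0.
    by move=> y ys; apply: dvw; have [] := rP _ (near_u x y xs ys).
  exists (u + x *: v + y *: w); first exact/rP/near_u.
  rewrite -yE -gE /D /g; ring.
have [q [_ _ q1] qE] : exists2 q, [/\ U q, `|fvw u - fvw q| < e / 2 &
    `|fwv u - fwv q| < e / 2] & D = s * (s * fwv q).
  pose g a := f (a + s *: v) - f a.
  have [|y ys gE] := @MVT_line g (fun a => fw (a + s *: v) - fw a) u w s s0.
    move=> y ys; apply: is_deriveB.
      apply: is_derive_translate; apply: dw; rewrite addrAC.
      by have [] := rP _ (near_u s y s_in ys).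
    by apply: dw; have [] := rP _ (near_u 0 y o_in ys); rewrite scale0r addr0.
  have [|x xs xE] := @MVT_line fw fwv (u + y *: w) v s s0.
    by move=> x xs; apply: dwv; rewrite addrAC; have [] := rP _ (near_u x y xs ys).
  exists (u + x *: v + y *: w); first exact/rP/near_u.
  rewrite [u + x *: v + _]addrAC -xE -gE /D /g [u + s *: w + _]addrAC; ring.
have pq : fvw p = fwv q.
  by move: pE; rewrite qE => /(mulfI (lt0r_neq0 s0))/(mulfI (lt0r_neq0 s0)).
rewrite (_ : fvw u - fwv u = (fvw u - fvw p) - (fwv u - fwv q)); last first.
  by rewrite pq; ring.
by rewrite (le_trans (ler_normB _ _))// (splitr e) lerD// ltW.
Unshelve. all: by end_near. Qed.
End mixed_derivatives.

Lemma lipschitz_continuous (R : realType) (V W : normedModType R) (f : V -> W) K :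
  0 <= K -> (forall a b, `|f a - f b| <= K * `|a - b|) -> continuous f.
Proof.
move=> K0 lipf a; apply/cvgrPdist_lt => e e0.
(* [K] may be 0, so the estimate divides by [K + 1]. *)
have K1 : 0 < K + 1 by rewrite ltr_wpDl.
have e1 : 0 < e / (K + 1) by rewrite divr_gt0.
near=> b; rewrite (le_lt_trans (lipf _ _))//.
rewrite (@le_lt_trans _ _ ((K + 1) * `|a - b|))//.
  by rewrite ler_wpM2r// lerDl.
by rewrite mulrC -ltr_pdivlMr.
Unshelve. all: by end_near. Qed.

(** * Row vectors: sup norm, coordinatewise derivatives and Lipschitz bounds *)

Section row_vectors.
Variables (R : realType).

Lemma normrV_le n (x : 'rV[R]_n) e : 0 <= e -> (forall j, `|x 0 j| <= e) -> `|x| <= e.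
Proof.
move=> e0 xe; rewrite [leLHS]/Num.Def.normr/= mx_normrE.
by apply: bigmax_le => // -[i j] _ /=; rewrite ord1.
Qed.

Lemma ler_coord_norm n (x : 'rV[R]_n) j : `|x 0 j| <= `|x|.
Proof.
by rewrite [leRHS]/Num.Def.normr/= mx_normrE; exact: (le_bigmax _ _ (0, j)).
Qed.

Lemma is_derive_row (V : normedModType R) n (f : V -> 'rV[R]_n) a v (l : 'rV[R]_n) :
  (forall j, is_derive a v (fun x => f x 0 j) (l 0 j)) -> is_derive a v f l.
Proof.
move=> dfj; have df : derivable f a v.
  by apply/derivable_mxP => i j; rewrite ord1; have [] := dfj j.
split=> //; rewrite derive_mx//; apply/rowP => j; rewrite mxE.
by have [_] := dfj j.
Qed.

Lemma is_derive_coord (V : normedModType R) n (f : V -> 'rV[R]_n) a v l j :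
  is_derive a v f l -> is_derive a v (fun x => f x 0 j) (l 0 j).
Proof.
move=> [df <-]; rewrite derive_mx// mxE; apply: derivableP.
exact: (derivable_mxP _ _ _).1.
Qed.

Lemma derive_row_sum n (W : normedModType R) (f : 'rV[R]_n -> W) u v :
  differentiable f u -> 'D_v f u = \sum_j v 0 j *: 'D_(delta_mx 0 j) f u.
Proof.
move=> df; rewrite deriveE// {1}[v]row_sum_delta linear_sum.
by apply: eq_bigr => j _; rewrite linearZ/= deriveE.
Qed.

(** By continuity the partial derivatives are bounded near [u], and balls are convex, so the mean
    value theorem on the segment from [b] to [a] bounds each coordinate of the increment. *)
Lemma C1_lipschitz m n (U : set 'rV[R]_m) (F : 'rV[R]_m -> 'rV[R]_n) u :
    open U -> U u -> (forall i, Ck_on 1 U (fun a => F a 0 i)) ->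
  exists r K, [/\ 0 < r, 0 < K, ball u r `<=` U & forall a b,
    ball u r a -> ball u r b -> `|F a - F b| <= K * `|a - b|].
Proof.
move=> oU Uu C1F; pose D i j a := 'D_(delta_mx 0 j) (fun a => F a 0 i) a.
(* The sum over all [i] serves every coordinate at once; the last 1 keeps [K] positive when the sum
   is empty. *)
pose K := \sum_i \sum_j (`|D i j u| + 1) + 1.
have K0 : 0 < K by rewrite ltr_wpDl// sumr_ge0// => i _; rewrite sumr_ge0.
have : \forall a \near u, U a /\ forall i j, `|D i j a| <= `|D i j u| + 1.
  near=> a; split; first by near: a; exact: open_nbhs_nbhs.
  near: a; apply: filter_forall => i; apply: filter_forall => j.
  have [_ /(_ (delta_mx 0 j) u Uu)/cvgrPdist_lt/(_ 1 ltr01) Du] := C1F i.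
  near=> a; rewrite -lerBlDl (le_trans (lerB_dist _ _))// distrC ltW//.
  by near: a; exact: Du.
move=> /nbhs_ballP[r /= r0 rP]; exists r, K; split=> //; first by move=> a /rP[].
move=> a b ua ub; apply: normrV_le; first by rewrite mulr_ge0// ltW.
move=> i; rewrite !mxE.
have seg x : 0 <= x <= 1 -> ball u r (b + x *: (a - b)).
  move=> /andP[x0 x1]; move: ua ub; rewrite -!ball_normE/= => ua ub.
  have -> : u - (b + x *: (a - b)) = (1 - x) *: (u - b) + x *: (u - a).
    by apply/rowP => j; rewrite !mxE; ring.
  rewrite (le_lt_trans (ler_normD _ _))// !normrZ !ger0_norm ?subr_ge0//.
  have [->|x_neq0] := eqVneq x 0; first by rewrite subr0 mul0r addr0 mul1r.
  apply: (@lt_le_trans _ _ ((1 - x) * r + x * r)).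
    2: by rewrite -mulrDl subrK mul1r.
  by rewrite ler_ltD// ?ler_wpM2l ?subr_ge0 ?(ltW ub)// ltr_pM2l// lt0r x_neq0.
have [|x xI E] := @MVT_line _ _ (fun a => F a 0 i)
    (fun p => \sum_j (a - b) 0 j * D i j p) b (a - b) 1 ltr01.
  move=> x /seg/rP[Ux _]; have [dF _] := C1F i.
  split; first exact/diff_derivable/dF.
  by rewrite derive_row_sum//; exact: dF.
rewrite (_ : F a 0 i - F b 0 i = \sum_j (a - b) 0 j * D i j (b + x *: (a - b)));
  last by rewrite -[RHS]mul1r -E scale1r [b + _]addrC subrK.
have [_ Dx] := rP _ (seg x xI).
rewrite (le_trans (ler_norm_sum _ _ _))//.
apply: (@le_trans _ _ (\sum_j (`|D i j u| + 1) * `|a - b|)).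
  by apply: ler_sum => j _; rewrite normrM mulrC ler_pM// ler_coord_norm.
rewrite -mulr_suml ler_wpM2r// /K (bigD1 i)//= -addrA lerDl addr_ge0//.
by rewrite sumr_ge0// => k _; rewrite sumr_ge0.
Unshelve. all: by end_near. Qed.
End row_vectors.

(** * The Picard-Lindelof theorem *)

Section ODE.
Variable R : realType.

(** The integral starts at [- d] so that 0 and the negative times are interior; subtracting its
    value at 0 normalises it. *)
Lemma primitive (g : R -> R) (d : R) : continuous g -> 0 < d ->
  exists G : R -> R, G 0 = 0 /\ forall t : R, `|t| < d -> is_derive t 1 G (g t).
Proof.
move=> cg d0; pose F x : R := (\int[@lebesgue_measure R]_(t in [set` `[- d, x]]) g t)%R.
exists (fun x => F x - F 0); split; first by rewrite subrr.
move=> t; rewrite ltr_norml => /andP[dt td].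
have gi : (@lebesgue_measure R).-integrable `[- d, d] (EFin \o g).
  apply: continuous_compact_integrable; first exact: segment_compact.
  exact: continuous_subspaceT.
have [dF F'] := continuous_FTC1_closed td gi dt (cg t).
have FE : is_derive t 1 F (g t).
  by split; [exact: dF|rewrite -derive1E; exact: F'].
have := @is_deriveB _ _ _ F (cst (F 0)) t 1 (g t) 0 FE (is_derive_cst _ _ _).
by rewrite subr0.
Qed.

Lemma derive_bound_lipschitz (G g : R -> R) (d M : R) :
    (forall t : R, `|t| <= d -> is_derive t 1 G (g t)) ->
    (forall t : R, `|t| <= d -> `|g t| <= M) ->
  forall s t, `|s| <= d -> `|t| <= d -> `|G s - G t| <= M * `|s - t|.
Proof.
move=> dG gM s t; wlog st : s t / t < s => [H|sd td].
  have [/H//|/H H' sd td|-> _ _] := ltgtP t s; last by rewrite !subrr normr0 mulr0.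
  by rewrite distrC [X in _ * X]distrC H'.
have in_d (x : R) : 0 <= x <= s - t -> `|t + x *: (1 : R)| <= d.
  rewrite [x *: 1]mulr1 => /andP[x0 xs]; move: sd td; rewrite !ler_norml.
  by move=> /andP[? ?] /andP[? ?]; apply/andP; split; lra.
have [|x xI] := @MVT_line _ _ G g t 1 (s - t) _ (fun x xI => dG _ (in_d x xI)).
  by rewrite subr_gt0.
rewrite [(s - t) *: 1]mulr1 [t + _]addrC subrK => ->.
by rewrite normrM mulrC ler_wpM2r// gM// in_d.
Qed.

Definition clamp (lo hi x : R) : R := Num.max lo (Num.min x hi).

Lemma clamp_lipschitz lo hi x y : `|clamp lo hi x - clamp lo hi y| <= `|x - y|.
Proof.
have max_lip a b : `|Num.max lo a - Num.max lo b| <= `|a - b|.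
  rewrite ler_norml; have := ler_norm (a - b); have := ler_norm (b - a).
  rewrite distrC; case: (leP lo a) => ?; case: (leP lo b) => ? ? ?;
  by apply/andP; split; lra.
have min_lip a b : `|Num.min a hi - Num.min b hi| <= `|a - b|.
  rewrite ler_norml; have := ler_norm (a - b); have := ler_norm (b - a).
  rewrite distrC; case: (leP a hi) => ?; case: (leP b hi) => ? ? ?;
  by apply/andP; split; lra.
exact: le_trans (max_lip _ _) (min_lip _ _).
Qed.

Lemma clamp_itv lo hi x : lo <= hi -> lo <= clamp lo hi x <= hi.
Proof.
by move=> lohi; rewrite /clamp le_max lexx/= ge_max lohi ge_min lexx orbT.
Qed.

Lemma clamp_id lo hi x : lo <= x <= hi -> clamp lo hi x = x.
Proof. by move=> /andP[lox xhi]; rewrite /clamp min_l// max_r. Qed.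

(** Used to pass to the limit in estimates that hold for the [k]-th Picard iterate up to a geometric
    error. *)
Lemma le_geometric_limit (a b C : R) :
  (forall k, a <= b + C / 2 ^+ k) -> a <= b.
Proof.
move=> abC; apply/ler_addgt0Pr => e e0.
have [k Ck] : exists k, C / 2 ^+ k <= e.
  have [C0|C0] := leP C 0.
    exists 0%N; rewrite expr0 divr1; exact: le_trans (ltW e0).
  exists (Num.truncn (C / e)).+1; rewrite ler_pdivrMr ?exprn_gt0// mulrC -ler_pdivrMr//.
  apply: le_trans (ltW (truncnS_gt _)) _.
  by rewrite -natrX ler_nat ltnW// ltn_expl.
by apply: le_trans (abC k) _; rewrite lerD2l.
Qed.


(* Picard iteration, made total by clamping the space variable to a box around *)
(* [u], which is a ball for the sup norm, and the time variable to [-d, d].    *)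
Theorem picard_lindelof n (F : 'rV[R]_n -> 'rV[R]_n) (u : 'rV[R]_n) (r K : R) :
    0 < r -> 0 < K ->
    (forall a b, ball u r a -> ball u r b -> `|F a - F b| <= K * `|a - b|) ->
  exists d (c : R -> 'rV[R]_n), [/\ 0 < d, c 0 = u &
    forall t, `|t| < d -> ball u r (c t) /\ is_derive t 1 c (F (c t))].
Proof.
move=> r0 K0 lipF.
(* The closed box of half-width [rho] lies inside the ball of radius [r], where [F] is Lipschitz. *)
pose rho := r / 2; have rho0 : 0 < rho by rewrite divr_gt0.
have rhor : rho < r by rewrite ltr_pdivrMr// ltr_pMr// ltr1n.
pose proj (a : 'rV[R]_n) : 'rV[R]_n :=
  \row_j clamp (u 0 j - rho) (u 0 j + rho) (a 0 j).
have proj_lip a b : `|proj a - proj b| <= `|a - b|.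
  apply: normrV_le => // j; rewrite !mxE (le_trans (clamp_lipschitz _ _ _ _))//.
  by have := ler_coord_norm (a - b) j; rewrite !mxE.
have proj_ball a : `|u - proj a| <= rho.
  apply: normrV_le => [|j]; first exact: ltW.
  have /andP[lo hi] :
      u 0 j - rho <= clamp (u 0 j - rho) (u 0 j + rho) (a 0 j) <= u 0 j + rho.
    by apply: clamp_itv; lra.
  by rewrite !mxE ler_norml; apply/andP; split; lra.
have proj_id a : `|a - u| <= rho -> proj a = a.
  move=> au; apply/rowP => j; rewrite mxE clamp_id//.
  have := le_trans (ler_coord_norm (a - u) j) au.
  by rewrite !mxE ler_norml => /andP[? ?]; apply/andP; split; lra.
have rho_ball a : `|u - a| <= rho -> ball u r a.
  by move=> ua; rewrite -ball_normE/=; exact: le_lt_trans rhor.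
(* [G] agrees with [F] on the box and is Lipschitz and bounded everywhere. *)
pose G a := F (proj a).
have lipG a b : `|G a - G b| <= K * `|a - b|.
  apply: le_trans (lipF _ _ (rho_ball _ (proj_ball a)) (rho_ball _ (proj_ball b))) _.
  by rewrite ler_wpM2l// ltW.
pose B := `|F u| + K * rho.
have B0 : 0 <= B by rewrite addr_ge0// mulr_ge0// ltW.
have boundG a : `|G a| <= B.
  rewrite -[G a](subrK (F u)) (le_trans (ler_normD _ _))// addrC lerD2l.
  rewrite (le_trans (lipF _ _ (rho_ball _ (proj_ball a)) (ballxx _ r0)))//.
  by rewrite ler_wpM2l ?(ltW K0)// distrC.
(* The first summand makes the Picard operator a contraction of ratio 1/2 ([dK]), the second keeps
   its values in the box ([dB]). *)
pose d := (2 * K + B / rho)^-1.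
have di0 : 0 < 2 * K + B / rho by rewrite ltr_wpDr ?mulr_gt0// divr_ge0// ltW.
have d0 : 0 < d by rewrite invr_gt0.
have dK : d * K <= 2^-1.
  rewrite mulrC ler_pdivrMr//; have : 0 <= B / rho by rewrite divr_ge0// ltW.
  by move=> ?; lra.
have dB : B * d <= rho.
  rewrite ler_pdivrMr// mulrDr [rho * (B / rho)]mulrC divfK ?gt_eqF// lerDr.
  by rewrite !mulr_ge0// ltW.
pose theta (t : R) := clamp (- d) d t.
have theta_d t : `|theta t| <= d.
  by rewrite ler_norml; apply: clamp_itv; rewrite ge0_cp// ltW.
have theta_id t : `|t| <= d -> theta t = t by rewrite ler_norml; exact: clamp_id.
(* Primitives are taken on a longer interval, so that they are differentiable up to the endpoints of
   [-d, d]. *)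
have d2 : d < d *+ 2 by rewrite mulr2n ltrDl.
have d20 : 0 < d *+ 2 by rewrite mulrn_wgt0.
have /choice[P PP] : forall g : R -> R, exists p : R -> R, continuous g ->
    p 0 = 0 /\ forall t : R, `|t| <= d -> is_derive t 1 p (g t).
  move=> g.
  (* For a discontinuous [g] the chosen function is arbitrary. *)
  have [cg|ncg] := pselect (continuous g); last by exists g => /ncg.
  have [p [p0 dp]] := primitive cg d20.
  by exists p => _; split=> // t td; apply: dp; exact: le_lt_trans td d2.
pose g (y : R -> 'rV[R]_n) j (s : R) := (G (y s) : 'rV[R]_n) 0 j : R.
have cG y : continuous (y : R -> 'rV[R]_n) -> forall j, continuous (g y j).
  move=> cy j t; apply: (@continuous_comp _ _ _ (G \o y) (fun a : 'rV[R]_n => a 0 j));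
    last exact: coord_continuous.
  apply: (@continuous_comp _ _ _ y G); first exact: cy.
  exact: lipschitz_continuous (ltW K0) lipG _.
pose T (y : R -> 'rV[R]_n) (t : R) : 'rV[R]_n := u + \row_j P (g y j) (theta t).
have T_lip (y : R -> 'rV[R]_n) : continuous y ->
    forall s t, `|T y s - T y t| <= B * `|s - t|.
  move=> cy s t; apply: normrV_le => [|j]; first by rewrite mulr_ge0.
  rewrite !mxE opprD addrACA subrr add0r.
  have [_ dP] := PP _ (cG _ cy j).
  apply: le_trans (derive_bound_lipschitz dP _ (theta_d s) (theta_d t)) _.
    by move=> x _; rewrite (le_trans (ler_coord_norm _ _)).
  by rewrite ler_wpM2l// clamp_lipschitz.
have T_contract (y z : R -> 'rV[R]_n) e :
    continuous y -> continuous z -> (forall s, `|y s - z s| <= e) ->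
    forall t, `|T y t - T z t| <= e / 2.
  move=> cy cz yz t.
  have e0 : 0 <= e := le_trans (normr_ge0 _) (yz 0).
  apply: normrV_le => [|j]; first by rewrite divr_ge0.
  rewrite !mxE opprD addrACA subrr add0r.
  have [Py0 dPy] := PP _ (cG _ cy j); have [Pz0 dPz] := PP _ (cG _ cz j).
  have dPyz (s : R) : `|s| <= d ->
      is_derive s 1 (fun t => P (g y j) t - P (g z j) t) (g y j s - g z j s).
    by move=> sd; apply: is_deriveB; [exact: dPy|exact: dPz].
  have o_d : `|0 : R| <= d by rewrite normr0 ltW.
  have := derive_bound_lipschitz dPyz (M := K * e) _ (theta_d t) o_d.
  rewrite Py0 Pz0 !subr0; move=> H; apply: le_trans (H _) _.
    move=> s _; have := ler_coord_norm (G (y s) - G (z s)) j.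
    rewrite !mxE => /le_trans; apply; rewrite (le_trans (lipG _ _))//.
    by rewrite ler_wpM2l// ltW.
  apply: (@le_trans _ _ (K * e * d)).
    by rewrite ler_wpM2l ?theta_d// mulr_ge0// ltW.
  by rewrite mulrC mulrA mulrC ler_wpM2l.
pose y k : R -> 'rV[R]_n := iter k T (cst u).
have cT (z : R -> 'rV[R]_n) : continuous z -> continuous (T z).
  by move=> cz; exact: lipschitz_continuous B0 (T_lip z cz).
have cy k : continuous (y k).
  by elim: k => [|k IHk]; [exact: cst_continuous|exact: cT].
have T_u (z : R -> 'rV[R]_n) t : continuous z -> `|u - T z t| <= rho.
  move=> cz; apply: normrV_le => [|j]; first exact: ltW.
  rewrite !mxE opprD addrA subrr add0r normrN.
  have [P0 dP] := PP _ (cG _ cz j).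
  have o_d : `|0 : R| <= d by rewrite normr0 ltW.
  have := derive_bound_lipschitz dP (M := B) _ (theta_d t) o_d.
  rewrite P0 !subr0 => H; apply: le_trans (H _) _.
    by move=> x _; rewrite (le_trans (ler_coord_norm _ _)).
  by rewrite (le_trans _ dB)// ler_wpM2l.
have y_step k t : `|y k.+1 t - y k t| <= rho / 2 ^+ k.
  elim: k t => [|k IHk] t.
    by rewrite expr0 divr1 distrC; apply: T_u; exact: (cy 0%N).
  rewrite exprSr invfM mulrA.
  exact: T_contract (cy k.+1) (cy k) IHk t.
have half k : 2 * rho / 2 ^+ k.+1 = rho / 2 ^+ k.
  by rewrite exprS invfM mulrACA divff ?mul1r// pnatr_eq0.
have y_dist k j t : `|y (k + j)%N t - y k t| <= 2 * rho / 2 ^+ k.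
  (* The bound is sharpened to the exact partial geometric sum, which makes the induction on [j] go
     through. *)
  suff : `|y (k + j)%N t - y k t| <= 2 * rho / 2 ^+ k - 2 * rho / 2 ^+ (k + j).
    by move=> /le_trans; apply; rewrite gerBl divr_ge0 ?mulr_ge0 ?exprn_ge0// ltW.
  elim: j => [|j IHj]; first by rewrite addn0 !subrr normr0.
  rewrite addnS half -(subrKA (y (k + j)%N t)) (le_trans (ler_normD _ _))//.
  have := y_step (k + j)%N t; have : 2 * rho / 2 ^+ (k + j) = 2 * (rho / 2 ^+ (k + j)).
    by rewrite mulrA.
  by move: IHj; lra.
have /choice[z zP] : forall t : R, exists l : 'rV[R]_n,
    forall k, `|l - y k t| <= 2 * rho / 2 ^+ k.
  move=> t; have y_near k : \forall m \near \oo, `|y k t - y m t| <= 2 * rho / 2 ^+ k.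
    by exists k => // m /= km; rewrite distrC -(subnKC km).
  have cvy : cvg ((y ^~ t) @ \oo).
    apply: cauchy_cvg; apply: cauchy_exP => e e0.
    have [k ke] : exists k, 2 * rho / 2 ^+ k < e.
      apply: contrapT => /forallNP nke.
      have : e <= 0.
        apply: (@le_geometric_limit _ _ (2 * rho)) => k; rewrite add0r.
        by have /negP := nke k; rewrite -leNgt.
      by rewrite leNgt e0.
    exists (y k t); near=> m; rewrite /= -ball_normE /=; apply: le_lt_trans ke.
    by near: m; exact: y_near.
  exists (lim ((y ^~ t) @ \oo)) => k; apply/ler_addgt0Pr => e e0.
  near \oo => m.
  rewrite -(subrKA (y m t)) (le_trans (ler_normD _ _))// addrC lerD//.
    by rewrite distrC; near: m; exact: y_near.
  rewrite ltW//; near: m; by move/cvgrPdist_lt : cvy; exact.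
(* All iterates share the Lipschitz constant [B], and it passes to the limit. *)
have cz : continuous z.
  have zlip s t : `|z s - z t| <= B * `|s - t|.
    apply: (@le_geometric_limit _ _ (2 * (2 * rho))) => k.
    have -> : z s - z t = (z s - y k s) + ((y k s - y k t) - (z t - y k t)).
      by rewrite opprB addrA subrKA subrKA.
    have ylip : `|y k s - y k t| <= B * `|s - t|.
      by case: k => [|k]; [rewrite subrr normr0 mulr_ge0|exact/T_lip/cy].
    rewrite (le_trans (ler_normD _ _))// (le_trans (lerD (lexx _) (ler_normB _ _)))//.
    have := zP s k; have := zP t k; rewrite -mulrA; move: ylip; lra.
  exact: lipschitz_continuous B0 zlip.
(* Both sides are geometrically close to [y k.+1 t], the right one because [T] contracts. *)
have zT t : z t = T z t.
  apply/eqP; rewrite -subr_eq0 -normr_le0.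
  apply: (@le_geometric_limit _ _ (2 * rho)) => k.
  rewrite -(subrKA (y k.+1 t)) (le_trans (ler_normD _ _))//.
  have yz s : `|y k s - z s| <= 2 * rho / 2 ^+ k by rewrite distrC.
  have := T_contract _ _ _ (cy k) cz yz t; have := zP t k.+1; rewrite half -!mulrA /=.
  by rewrite add0r; lra.
exists d, z; split=> //.
  rewrite zT /T theta_id ?normr0 ?ltW//; apply/rowP => j.
  by rewrite !mxE; have [-> _] := PP _ (cG _ cz j); rewrite addr0.
move=> t td; have zt : `|u - z t| <= rho by rewrite zT; exact: T_u.
split; first exact: rho_ball.
have -> : F (z t) = G (z t) by rewrite /G proj_id// distrC.
apply: is_derive_row => j; have [_ dP] := PP _ (cG _ cz j).
(* As [|t| < d] strictly, the time clamp is the identity near [t]. *)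
apply: (@near_eq_is_derive _ _ _ (fun s => u 0 j + P (g z j) s)).
  near=> s; rewrite [in RHS]zT !mxE theta_id//.
  have : `|s| < d; last exact: ltW.
  near: s; apply: (@cvgr_lt _ _ _ _ _ `|t|) td.
  by apply: cvg_norm.
by have := is_deriveD (is_derive_cst (u 0 j) t 1) (dP t (ltW td)); rewrite add0r.
Unshelve. all: by end_near. Qed.
End ODE.

(** * The Minkowski product *)

Section minkowski.
Variables (R : realType) (n : nat).
Implicit Types u v w : 'rV[R]_n.+1.

Definition mink_sign (j : 'I_n.+1) : R := if j == ord0 then -1 else 1.

Lemma minkE v w : mink v w = \sum_j mink_sign j * (v 0 j * w 0 j).
Proof.
rewrite /mink big_ord_recl /mink_sign eqxx mulN1r; congr (_ + _).
by apply: eq_bigr => j _; rewrite mul1r.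
Qed.

Lemma minkC v w : mink v w = mink w v.
Proof. by rewrite !minkE; apply: eq_bigr => j _; rewrite [v 0 j * _]mulrC. Qed.

Lemma minkDl u v w : mink (u + v) w = mink u w + mink v w.
Proof.
by rewrite !minkE -big_split/=; apply: eq_bigr => j _; rewrite !mxE mulrDl mulrDr.
Qed.

Lemma minkZl k v w : mink (k *: v) w = k * mink v w.
Proof.
rewrite !minkE mulr_sumr; apply: eq_bigr => j _; rewrite !mxE; ring.
Qed.

Lemma minkNl v w : mink (- v) w = - mink v w.
Proof. by rewrite -scaleN1r minkZl mulN1r. Qed.

Lemma minkBl u v w : mink (u - v) w = mink u w - mink v w.
Proof. by rewrite minkDl minkNl. Qed.

Lemma mink0l w : mink 0 w = 0.
Proof. by rewrite -(scale0r 0) minkZl mul0r. Qed.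

Lemma mink_suml (I : Type) (r : seq I) (P : pred I) (F : I -> 'rV[R]_n.+1) w :
  mink (\sum_(i <- r | P i) F i) w = \sum_(i <- r | P i) mink (F i) w.
Proof.
by apply: (big_morph (fun v => mink v w)) => [u v|]; rewrite ?minkDl ?mink0l.
Qed.

Lemma minkDr u v w : mink u (v + w) = mink u v + mink u w.
Proof. by rewrite minkC minkDl !(minkC u). Qed.

Lemma minkZr k v w : mink v (k *: w) = k * mink v w.
Proof. by rewrite minkC minkZl minkC. Qed.

Lemma mink_sumr (I : Type) (r : seq I) (P : pred I) (F : I -> 'rV[R]_n.+1) w :
  mink w (\sum_(i <- r | P i) F i) = \sum_(i <- r | P i) mink w (F i).
Proof. by rewrite minkC mink_suml; apply: eq_bigr => i _; exact: minkC. Qed.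

Lemma mink_nondegenerate v : (forall w, mink v w = 0) -> v = 0.
Proof.
move=> v0; apply/rowP => j; rewrite mxE.
have := v0 (delta_mx 0 j); rewrite minkE (bigD1 j)//= big1 => [|k kj]; last first.
  by rewrite !mxE (negPf kj) andbF !mulr0.
rewrite !mxE !eqxx mulr1 addr0 /mink_sign; case: ifP => _ /eqP.
  by rewrite mulN1r oppr_eq0 => /eqP.
by rewrite mul1r => /eqP.
Qed.

Lemma is_derive_mink (V : normedModType R) (f g : V -> 'rV[R]_n.+1) (a d : V)
    (df dg : 'rV[R]_n.+1) :
    is_derive a d f df -> is_derive a d g dg ->
  is_derive a d (fun x => mink (f x) (g x)) (mink df (g a) + mink (f a) dg).
Proof.
move=> Df Dg; have Dfj j := is_derive_coord j Df; have Dgj j := is_derive_coord j Dg.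
have -> : (fun x => mink (f x) (g x)) =
    \sum_j (mink_sign j *: ((fun x => f x 0 j) * (fun x => g x 0 j))).
  apply/funext => x; rewrite fct_sumE minkE.
  by apply: eq_bigr => j _.
apply: is_derive_eq; rewrite !minkE -big_split/=; apply: eq_bigr => j _.
rewrite /GRing.scale /=; ring.
Qed.

End minkowski.

(** * Product rules and derivatives of smooth fields *)

Section derivative_rules.
Variables (R : realType) (V : normedModType R).

Lemma is_derive_scale n (k : V -> R) (f : V -> 'rV[R]_n) a v dk df :
    is_derive a v k dk -> is_derive a v f df ->
  is_derive a v (fun x => k x *: f x) (dk *: f a + k a *: df).
Proof.
move=> Dk Df; apply: is_derive_row => j; have Dfj := is_derive_coord j Df.
have -> : (fun x => (k x *: f x) 0 j) = k * (fun x => f x 0 j).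
  by apply/funext => x; rewrite !mxE.
by apply: is_derive_eq; rewrite !mxE /GRing.scale/=; ring.
Qed.

Lemma near_eq_continuous (W : normedModType R) (f g : V -> W) a :
  {near a, f =1 g} -> {for a, continuous f} -> {for a, continuous g}.
Proof.
move=> fg; rewrite /prop_for /continuous_at -(nbhs_singleton fg).
by apply: cvg_trans; apply: near_eq_cvg; apply: filterS fg => x ->.
Qed.

(** The square is what is known to be constant: a unit field has <f, f> equal to 1 or -1, with a
    sign that could a priori depend on the point. *)
Lemma derive_sqr1 (f : V -> R) a v l : is_derive a v f l ->
  (\near a, f a * f a = 1) -> l = 0.
Proof.
move=> Df f1; have := @is_deriveM _ _ f f a v _ _ Df Df.
move=> Dff; have := near_eq_is_derive f1 Dff => -[_].
rewrite derive_cst => /esym/eqP; rewrite /GRing.scale/= -mulr2n mulrn_eq0/=.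
rewrite mulf_eq0 => /orP[/eqP fa0|/eqP//].
by have := nbhs_singleton f1; rewrite fa0 mul0r => /eqP; rewrite eq_sym oner_eq0.
Qed.

Lemma C1_mink n (U : set V) (f g : V -> 'rV[R]_n.+1) : open U ->
    (forall j, Ck_on 1 U (fun a => f a 0 j)) ->
    (forall j, Ck_on 1 U (fun a => g a 0 j)) ->
  Ck_on 1 U (fun a => mink (f a) (g a)).
Proof.
move=> oU C1f C1g.
have -> : (fun a => mink (f a) (g a)) =
    fun a => \sum_j mink_sign R j * (f a 0 j * g a 0 j).
  by apply/funext => a; exact: minkE.
apply: C1_sum => // j _; apply: C1_mul => //; first exact: C1_cst.
exact: C1_mul.
Qed.

Lemma smooth_derive (W : normedModType R) (U : set V) (F : V -> W) v :
  smooth_on U F -> smooth_on U (fun a => 'D_v F a).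
Proof. by move=> sF k; have [_] := sF k.+1; exact. Qed.

Lemma smooth_is_derive (W : normedModType R) (U : set V) (F : V -> W) a v :
  smooth_on U F -> U a -> is_derive a v F ('D_v F a).
Proof. by move=> /(_ 1%N)[dF _] Ua; exact/derivableP/diff_derivable/dF. Qed.

Lemma smooth_coord_C1 n (U : set V) (F : V -> 'rV[R]_n) j : open U ->
  smooth_on U F -> Ck_on 1 U (fun a => F a 0 j).
Proof. by move=> oU /(_ 1%N); exact: C1_coord. Qed.

Lemma C1_is_derive (U : set V) (f : V -> R) a v :
  Ck_on 1 U f -> U a -> is_derive a v f ('D_v f a).
Proof. by move=> [df _] Ua; exact/derivableP/diff_derivable/df. Qed.

Lemma smooth_derive_commute n (U : set V) (F : V -> 'rV[R]_n) a v w :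
    open U -> smooth_on U F -> U a ->
  'D_v (fun x => 'D_w F x) a = 'D_w (fun x => 'D_v F x) a.
Proof.
move=> oU sF Ua; apply/rowP => j.
have coord (G : V -> 'rV[R]_n) b z : smooth_on U G -> U b ->
    is_derive b z (fun x => G x 0 j) (('D_z G b) 0 j).
  by move=> sG Ub; exact/is_derive_coord/smooth_is_derive.
apply: (@derive_commute _ _ U a w v (fun x => F x 0 j)
  (fun x => ('D_w F x) 0 j) (fun x => ('D_v F x) 0 j)
  (fun x => ('D_v (fun x => 'D_w F x) x) 0 j)
  (fun x => ('D_w (fun x => 'D_v F x) x) 0 j)) => //.
- by move=> b Ub; exact: coord.
- by move=> b Ub; exact: coord.
- by move=> b Ub; apply: coord => //; exact: smooth_derive.
- by move=> b Ub; apply: coord => //; exact: smooth_derive.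
- apply: C1_continuous Ua; apply: smooth_coord_C1 => //.
  by do 2!apply: smooth_derive.
- apply: C1_continuous Ua; apply: smooth_coord_C1 => //.
  by do 2!apply: smooth_derive.
Qed.

End derivative_rules.

(** * The hypersurface in a chart *)

Section chart.
Variables (R : realType) (n : nat) (M : topologicalType).
Variables (A : smooth_manifold R n M) (H : oriented_hypersurface A).
Hypothesis nondeg : nondegenerate_hypersurface H.
Hypothesis xT_neq0 : forall p, tangential_part H p <> 0.
Hypothesis xT_light : forall p, ~ lightlike (tangential_part H p).
Variable i : chart_idx A.

Local Notation U := (chart_img i).
Local Notation X := (position H \o param i).
Local Notation N := (normal H \o param i).
Local Notation e j := (delta_mx 0 j : 'rV[R]_n).
Local Notation G := (metric_coef H i).

Let oU : open U. Proof. exact: chart_img_open. Qed.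
Let sX : smooth_on U X. Proof. exact: position_smooth. Qed.
Let sN : smooth_on U N. Proof. exact: normal_smooth. Qed.

Definition frame (j : 'I_n) (u : 'rV[R]_n) : 'rV[R]_n.+1 := 'D_(e j) X u.

Lemma smooth_derive_sum (F : 'rV[R]_n -> 'rV[R]_n.+1) u v : smooth_on U F -> U u ->
  'D_v F u = \sum_j v 0 j *: 'D_(e j) F u.
Proof. by move=> /(_ 1%N)[dF _] Uu; exact/derive_row_sum/dF. Qed.

Lemma metric_coefE u k l : G u k l = mink (frame k u) (frame l u).
Proof. by rewrite mxE. Qed.

Lemma mink_normal_neq0 u : mink (N u) (N u) != 0.
Proof.
by have [-> | ->] := normal_unit H (param i u); rewrite ?oppr_eq0 oner_eq0.
Qed.

Lemma mink_tangent u v l : U u ->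
  mink ('D_v X u) (frame l u) = (v *m G u) 0 l.
Proof.
move=> Uu; rewrite smooth_derive_sum// mink_suml mxE; apply: eq_bigr => k _.
by rewrite minkZl metric_coefE.
Qed.

Lemma metric_coef_unit u : U u -> G u \in unitmx.
Proof.
move=> Uu; rewrite -row_free_unit; apply: inj_row_free => v vG.
apply: (nondeg Uu) => w; rewrite /induced_metric [X in mink _ X]smooth_derive_sum//.
rewrite mink_sumr big1// => l _.
by rewrite minkZr [mink _ _](mink_tangent v l Uu) vG mxE mulr0.
Qed.

(* The frame and the normal are [n.+1] linearly independent vectors. *)
Lemma tangent_normal_eq0 u w : U u -> mink w (N u) = 0 ->
  (forall l, mink w (frame l u) = 0) -> w = 0.
Proof.
move=> Uu wN wX.
pose B : 'M[R]_(1 + n, n.+1) := col_mx (N u) (\matrix_l frame l u).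
have Bfree : row_free B.
  apply: inj_row_free => v; rewrite -[v]hsubmxK mul_row_col.
  set a := lsubmx v; set b := rsubmx v.
  have -> : a *m N u = a 0 0 *: N u by rewrite {1}[a]mx11_scalar mul_scalar_mx.
  have -> : b *m (\matrix_l frame l u) = 'D_b X u.
    rewrite smooth_derive_sum// mulmx_sum_row.
    by apply: eq_bigr => l _; rewrite rowK.
  move=> ab0.
  have a0 : a 0 0 = 0.
    have := congr1 (mink (N u)) ab0; rewrite minkDr minkZr.
    rewrite [mink (N u) ('D_b X u)]normal_orthogonal// addr0 minkC mink0l => /eqP.
    by rewrite mulf_eq0 (negPf (mink_normal_neq0 u)) orbF => /eqP.
  have b0 : b = 0.
    apply: (@position_immersion _ _ _ _ H i u) => //.
    by move: ab0; rewrite a0 scale0r add0r.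
  rewrite b0 (_ : a = 0) ?row_mx0//.
  by apply/rowP => j; rewrite !ord1 a0 mxE.
have Bfull : row_full B by rewrite row_full_unit -row_free_unit.
apply: mink_nondegenerate => z.
have /submxP[c ->] : (z <= B)%MS by exact: submx_full.
rewrite -[c]hsubmxK mul_row_col minkDr.
rewrite {1}[lsubmx c]mx11_scalar mul_scalar_mx minkZr wN mulr0 add0r.
rewrite mulmx_sum_row mink_sumr big1// => l _.
by rewrite minkZr rowK wX mulr0.
Qed.

(* Written with the adjugate, so that it is visibly smooth in [u]. *)
Definition tangent_coord (w : 'rV[R]_n.+1) (u : 'rV[R]_n) : 'rV[R]_n :=
  \row_k \sum_l (\det (G u))^-1 * (\adj (G u)) l k * mink w (frame l u).

Lemma tangent_coordK u w : U u -> mink w (N u) = 0 ->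
  'D_(tangent_coord w u) X u = w.
Proof.
move=> Uu wN; apply/eqP; rewrite -subr_eq0; apply/eqP.
have uG := metric_coef_unit Uu.
apply: (tangent_normal_eq0 Uu).
  rewrite minkBl wN subr0 minkC [LHS](@normal_orthogonal _ _ _ _ H)//.
move=> l; rewrite minkBl [mink _ _](mink_tangent _ l Uu).
have -> : tangent_coord w u = (\row_l mink w (frame l u)) *m invmx (G u).
  apply/rowP => k; rewrite /invmx uG !mxE; apply: eq_bigr => m _.
  by rewrite !mxE mulrC.
by rewrite mulmxKV// mxE subrr.
Qed.

Lemma tangent_coord_uniq u v w : U u -> 'D_v X u = 'D_w X u -> v = w.
Proof.
move=> Uu vw; apply/eqP; rewrite -subr_eq0; apply/eqP.
apply: (@position_immersion _ _ _ _ H i u) => //.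
have dX : differentiable X u by have [dX _] := sX 1%N; exact: dX.
by rewrite [LHS]derive_subr// vw subrr.
Qed.

(** * The tangential part of the position and the unit field e_1 *)

Local Notation xT u := (tangential_part H (param i u)).
Local Notation e1 u := (unit_tangential H (param i u)).

Definition support_coef (u : 'rV[R]_n) : R := mink (X u) (N u) / mink (N u) (N u).
Definition tangential_norm2 (u : 'rV[R]_n) : R := mink (xT u) (xT u).
Definition unit_coef (u : 'rV[R]_n) : R :=
  (Num.sqrt (Num.sg (tangential_norm2 u) * tangential_norm2 u))^-1.
Definition unit_coord (u : 'rV[R]_n) : 'rV[R]_n := tangent_coord (e1 u) u.

Local Notation mu := support_coef.
Local Notation q := tangential_norm2.
Local Notation h := unit_coef.
Local Notation V := unit_coord.

Lemma xTE u : xT u = X u - mu u *: N u. Proof. by []. Qed.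
Lemma e1E u : e1 u = h u *: xT u. Proof. by []. Qed.

Lemma mink_xT_normal u : mink (xT u) (N u) = 0.
Proof.
by rewrite xTE minkBl minkZl /support_coef divfK ?subrr// mink_normal_neq0.
Qed.

Lemma mink_e1_normal u : mink (e1 u) (N u) = 0.
Proof. by rewrite e1E minkZl mink_xT_normal mulr0. Qed.

Lemma tangential_norm2_neq0 u : q u != 0.
Proof.
by apply/eqP => q0; apply: (xT_light (p := param i u)); split=> //; exact/eqP.
Qed.

(** Replacing the sign by the square root of a square removes the case distinction on the sign of
    [q] and makes the regularity of [h] visible. *)
Lemma unit_coefE u : h u = (Num.sqrt (Num.sqrt (q u * q u)))^-1.
Proof. by rewrite /unit_coef -expr2 sqrtr_sqr normrEsg. Qed.

Lemma unit_coef_neq0 u : h u != 0.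
Proof.
rewrite unit_coefE invr_neq0// sqrtr_eq0 -ltNge sqrtr_gt0 -expr2.
by rewrite exprn_even_gt0//= tangential_norm2_neq0.
Qed.

Lemma mink_e1_sqr u : mink (e1 u) (e1 u) * mink (e1 u) (e1 u) = 1.
Proof.
rewrite e1E minkZl minkZr -/(tangential_norm2 u).
rewrite (_ : _ * _ = (h u ^+ 4) * (q u * q u)); last by ring.
rewrite unit_coefE exprVn -[4%N]/(2 * 2)%N exprM !sqr_sqrtr ?sqrtr_ge0//.
  by rewrite mulVf// mulf_neq0// tangential_norm2_neq0.
by rewrite -expr2 sqr_ge0.
Qed.

Lemma unit_coordK u : U u -> 'D_(V u) X u = e1 u.
Proof. by move=> Uu; apply: tangent_coordK => //; exact: mink_e1_normal. Qed.

(** * C1 regularity of e_1 and of its coordinates *)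

Let C1X j : Ck_on 1 U (fun u => X u 0 j). Proof. exact: smooth_coord_C1. Qed.
Let C1N j : Ck_on 1 U (fun u => N u 0 j). Proof. exact: smooth_coord_C1. Qed.

Lemma frame_C1 k j : Ck_on 1 U (fun u => frame k u 0 j).
Proof. by apply: smooth_coord_C1 => //; exact: smooth_derive. Qed.

Lemma support_coef_C1 : Ck_on 1 U mu.
Proof.
apply: C1_mul => //; first exact: C1_mink.
apply: C1_inv => //; first exact: C1_mink.
by move=> u _; exact: mink_normal_neq0.
Qed.

Lemma xT_C1 j : Ck_on 1 U (fun u => xT u 0 j).
Proof.
have -> : (fun u => xT u 0 j) = fun u => X u 0 j + - (mu u * N u 0 j).
  by apply/funext => u; rewrite xTE !mxE.
exact: (C1_add oU (C1X j) (C1_opp oU (C1_mul oU support_coef_C1 (C1N j)))).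
Qed.

Lemma tangential_norm2_C1 : Ck_on 1 U q.
Proof. exact: (C1_mink oU xT_C1 xT_C1). Qed.

Lemma unit_coef_C1 : Ck_on 1 U h.
Proof.
have -> : h = fun u => (Num.sqrt (Num.sqrt (q u * q u)))^-1.
  by apply/funext => u; exact: unit_coefE.
have qq0 u : 0 < Num.sqrt (q u * q u).
  by rewrite sqrtr_gt0 -expr2 exprn_even_gt0//= tangential_norm2_neq0.
apply: C1_inv => //; last by move=> u _; rewrite gt_eqF// sqrtr_gt0.
apply: C1_sqrt => //; apply: C1_sqrt => //.
  exact: (C1_mul oU tangential_norm2_C1 tangential_norm2_C1).
by move=> u _; rewrite -sqrtr_gt0.
Qed.

Lemma e1_C1 j : Ck_on 1 U (fun u => e1 u 0 j).
Proof.
have -> : (fun u => e1 u 0 j) = fun u => h u * xT u 0 j.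
  by apply/funext => u; rewrite e1E mxE.
exact: (C1_mul oU unit_coef_C1 (xT_C1 j)).
Qed.

Lemma metric_coef_C1 k l : Ck_on 1 U (fun u => G u k l).
Proof.
have -> : (fun u => G u k l) = fun u => mink (frame k u) (frame l u).
  by apply/funext => u; exact: metric_coefE.
exact: (C1_mink oU (frame_C1 k) (frame_C1 l)).
Qed.

Lemma unit_coord_C1 k : Ck_on 1 U (fun u => V u 0 k).
Proof.
have -> : (fun u => V u 0 k) = fun u =>
    \sum_l (\det (G u))^-1 * (\adj (G u)) l k * mink (e1 u) (frame l u).
  by apply/funext => u; rewrite mxE.
apply: C1_sum => // l _.
have C1det : Ck_on 1 U (fun u => (\det (G u))^-1).
  apply: (C1_inv oU (C1_det oU metric_coef_C1)).
  by move=> u /metric_coef_unit; rewrite unitmxE unitfE.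
have C1adj := C1_adjugate oU l k metric_coef_C1.
exact: (C1_mul oU (C1_mul oU C1det C1adj) (C1_mink oU e1_C1 (frame_C1 l))).
Qed.

(** * The acceleration of e_1 against the derivative of the normal *)

Definition unit_accel (u : 'rV[R]_n) : 'rV[R]_n.+1 := 'D_(V u) (fun x => e1 x) u.

Definition normal_rate (u : 'rV[R]_n) : 'rV[R]_n.+1 := 'D_(V u) N u.
Local Notation DN := normal_rate.

Lemma unit_coef_is_derive u v : U u -> is_derive u v h ('D_v h u).
Proof. by move=> Uu; exact: (C1_is_derive v unit_coef_C1 Uu). Qed.

Lemma e1_is_derive u v : U u -> is_derive u v (fun x => e1 x) ('D_v (fun x => e1 x) u).
Proof.
move=> Uu; apply: derivableP; apply/derivable_mxP => k j; rewrite ord1.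
by have [] := C1_is_derive v (e1_C1 j) Uu.
Qed.

Lemma unit_coord_is_derive u v : U u -> is_derive u v V ('D_v V u).
Proof.
move=> Uu; apply: derivableP; apply/derivable_mxP => k j; rewrite ord1.
by have [] := C1_is_derive v (unit_coord_C1 j) Uu.
Qed.

Lemma mink_derive_normal u v : U u -> mink ('D_v N u) (N u) = 0.
Proof.
move=> Uu; have DNu := smooth_is_derive v sN Uu.
have := derive_sqr1 (is_derive_mink DNu DNu) _.
rewrite [mink (N u) _]minkC -mulr2n => H0.
have /eqP : mink ('D_v N u) (N u) *+ 2 = 0.
  apply: H0; near=> x.
  by have [-> | ->] := normal_unit H (param i x); rewrite ?mulrNN mulr1.
by rewrite mulrn_eq0/= => /eqP.
Unshelve. all: by end_near. Qed.

Lemma mink_accel_e1 u : U u -> mink (unit_accel u) (e1 u) = 0.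
Proof.
move=> Uu; have De1 := e1_is_derive (V u) Uu.
have := derive_sqr1 (is_derive_mink De1 De1) _.
rewrite [mink (e1 u) _]minkC -mulr2n => H0.
have /eqP : mink (unit_accel u) (e1 u) *+ 2 = 0.
  by apply: H0; near=> x; exact: mink_e1_sqr.
by rewrite mulrn_eq0/= => /eqP.
Unshelve. all: by end_near. Qed.

(** The product rule for e_1 = h (x - mu N) along e_1: the derivative of x is e_1 itself, a multiple
    of x^T, and the term in N vanishes against tangent vectors. *)
Lemma mink_accel u : U u -> exists b, forall w, mink (N u) w = 0 ->
  mink (unit_accel u) w = b * mink (xT u) w - h u * mu u * mink (DN u) w.
Proof.
move=> Uu; exists ('D_(V u) h u + h u * h u) => w Nw.
have Dh := unit_coef_is_derive (V u) Uu.
have Dmu := C1_is_derive (V u) support_coef_C1 Uu.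
have DX := smooth_is_derive (V u) sX Uu; have DNu := smooth_is_derive (V u) sN Uu.
have De1 := is_derive_scale Dh (is_deriveB DX (is_derive_scale Dmu DNu)).
have -> : unit_accel u = 'D_(V u) h u *: (X u - mu u *: N u) +
    h u *: ('D_(V u) X u - ('D_(V u) mu u *: N u + mu u *: 'D_(V u) N u)).
  by have [_ <-] := De1.
have alg (T Nu D : 'rV[R]_n.+1) (a b c m : R) : mink Nu w = 0 ->
    mink (a *: T + b *: (b *: T - (c *: Nu + m *: D))) w
    = (a + b * b) * mink T w - b * m * mink D w.
  by move=> Nuw; rewrite minkDl !minkZl minkBl minkDl !minkZl Nuw; ring.
by rewrite unit_coordK// e1E -xTE alg.
Qed.

(** By [mink_accel] the acceleration pairs with tangent vectors like c x^T. Taking e_1 as test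
    vector gives c = 0, since the acceleration is orthogonal to e_1 while x^T, not being light-like,
    is not. *)
Lemma geodesic_of_principal u k : U u -> DN u = k *: e1 u ->
  forall l, mink (unit_accel u) (frame l u) = 0.
Proof.
move=> Uu DNe; have [b Hb] := mink_accel Uu.
pose c := b - h u * mu u * k * h u.
have E w : mink (N u) w = 0 -> mink (unit_accel u) w = c * mink (xT u) w.
  by move=> /Hb ->; rewrite DNe e1E !minkZl /c; ring.
have c0 : c = 0.
  have := E (e1 u); rewrite mink_accel_e1// minkC mink_e1_normal => /(_ erefl)/esym/eqP.
  rewrite e1E minkZr !mulf_eq0 (negPf (unit_coef_neq0 u)).
  by rewrite (negPf (tangential_norm2_neq0 u)) !orbF => /eqP.
move=> l; rewrite E ?c0 ?mul0r//.
exact: (@normal_orthogonal _ _ _ _ H).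
Qed.

(** Differentiating <N, D_v X> = 0 along [w] turns each side into minus the pairing of N with a
    second derivative of X, and second derivatives commute. *)
Lemma shape_symmetric u v w : U u ->
  mink ('D_w N u) ('D_v X u) = mink ('D_v N u) ('D_w X u).
Proof.
move=> Uu.
have half v' w' :
    mink ('D_w' N u) ('D_v' X u) = - mink (N u) ('D_w' (fun x => 'D_v' X x) u).
  have D := is_derive_mink (smooth_is_derive w' sN Uu)
    (smooth_is_derive w' (smooth_derive v' sX) Uu).
  have near0 : \near u, mink (N u) ('D_v' X u) = 0.
    near=> x; apply: (@normal_orthogonal _ _ _ _ H).
    by near: x; exact: open_nbhs_nbhs.
  have [_] := near_eq_is_derive near0 D.
  by rewrite derive_cst => /esym/eqP; rewrite addr_eq0 => /eqP.
by rewrite !half (smooth_derive_commute v w oU sX Uu).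
Unshelve. all: by end_near. Qed.

(* [q u] times the component of [DN u] orthogonal to [xT u]. *)
Definition transverse_rate (u : 'rV[R]_n) : 'rV[R]_n.+1 :=
  q u *: DN u - mink (DN u) (xT u) *: xT u.
Local Notation psi := transverse_rate.

Lemma transverse_rate_continuous u j : U u -> {for u, continuous (fun x => psi x 0 j)}.
Proof.
move=> Uu.
(* Expanding in fixed directions makes the regularity visible; the expansion agrees with [DN] on [U]
   only. *)
pose DN' x : 'rV[R]_n.+1 := \sum_k V x 0 k *: 'D_(e k) N x.
have C1DN l : Ck_on 1 U (fun x => DN' x 0 l).
  have -> : (fun x => DN' x 0 l) = fun x => \sum_k V x 0 k * ('D_(e k) N x) 0 l.
    by apply/funext => x; rewrite summxE; apply: eq_bigr => k _; rewrite mxE.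
  apply: C1_sum => // k _.
  exact: (C1_mul oU (unit_coord_C1 k) (smooth_coord_C1 l oU (smooth_derive (e k) sN))).
have C1psi : Ck_on 1 U (fun x => q x * DN' x 0 j - mink (DN' x) (xT x) * xT x 0 j).
  apply: (C1_add oU (C1_mul oU tangential_norm2_C1 (C1DN j))); apply: (C1_opp oU).
  exact: (C1_mul oU (C1_mink oU C1DN xT_C1) (xT_C1 j)).
have psiE x : U x -> q x * DN' x 0 j - mink (DN' x) (xT x) * xT x 0 j = psi x 0 j.
  by move=> Ux; rewrite /transverse_rate /normal_rate (smooth_derive_sum _ sN Ux) !mxE.
apply: near_eq_continuous (C1_continuous C1psi Uu).
by near=> x; apply: psiE; near: x; exact: open_nbhs_nbhs.
Unshelve. all: by end_near. Qed.

Lemma principal_of_geodesic : (forall u l, U u -> mink (unit_accel u) (frame l u) = 0) ->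
  forall u, U u -> exists k, DN u = k *: e1 u.
Proof.
move=> geo u Uu.
(* With zero tangential acceleration, [mink_accel] reads b x^T = h mu DN, which can be solved for
   [DN]. *)
have step x : U x -> mu x != 0 -> exists k, DN x = k *: xT x.
  move=> Ux mux; have [b Hb] := mink_accel Ux.
  have NX l : mink (N x) (frame l x) = 0 by exact: (@normal_orthogonal _ _ _ _ H).
  have /eqP : b *: xT x - (h x * mu x) *: DN x = 0.
    apply: (tangent_normal_eq0 Ux).
      by rewrite minkBl !minkZl mink_xT_normal mink_derive_normal// !mulr0 subrr.
    by move=> l; rewrite minkBl !minkZl -Hb// geo.
  rewrite subr_eq0 => /eqP E; exists ((h x * mu x)^-1 * b).
  by rewrite -scalerA E scalerA mulVf ?scale1r// mulf_neq0// unit_coef_neq0.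
have from_xT k : DN u = k *: xT u -> exists k, DN u = k *: e1 u.
  by move=> ->; exists (k / h u); rewrite e1E scalerA divfK// unit_coef_neq0.
have [mu0|mu_neq0] := eqVneq (mu u) 0; last by have [k /from_xT] := step u Uu mu_neq0.
have [psi0|/rV0Pn[j psij]] := eqVneq (psi u) 0.
  apply: (from_xT ((q u)^-1 * mink (DN u) (xT u))).
  rewrite -scalerA; move/eqP: psi0; rewrite subr_eq0 => /eqP <-.
  by rewrite scalerA mulVf ?scale1r// tangential_norm2_neq0.
exists 0; rewrite scale0r.
(* Near [u] the coordinate [j] of [psi] stays nonzero, whereas [step] would make [psi] vanish
   wherever [mu] does not. *)
have mu_near : \near u, mink (X u) (N u) = 0.
  have psi_near : \forall x \near u, psi x 0 j != 0.
    have cpsi : (fun x => psi x 0 j) x @[x --> u] --> psi u 0 j.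
      exact: transverse_rate_continuous Uu.
    exact: cvgr_neq0 cpsi psij.
  near=> x; have Ux : U x by near: x; exact: open_nbhs_nbhs.
  have [|mux] := eqVneq (mu x) 0.
    by move/eqP; rewrite mulf_eq0 invr_eq0 (negPf (mink_normal_neq0 x)) orbF => /eqP.
  have [k DNx] := step x Ux mux; have : psi x 0 j != 0 by near: x; exact: psi_near.
  by rewrite /transverse_rate DNx minkZl -/(tangential_norm2 x) scalerA mulrC subrr mxE eqxx.
apply: (tangent_normal_eq0 Uu); first exact: mink_derive_normal.
(* By symmetry the pairing becomes that of e_1 with D_l N. Differentiating <x, N> = 0 leaves <x, D_l
   N> = 0, and at [u] the vector x is x^T. *)
move=> l; rewrite /frame -(shape_symmetric _ _ Uu) unit_coordK//.
have D := is_derive_mink (smooth_is_derive (e l) sX Uu) (smooth_is_derive (e l) sN Uu).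
have [_] := near_eq_is_derive mu_near D; rewrite derive_cst.
rewrite minkC [mink (N u) _](@normal_orthogonal _ _ _ _ H)// add0r.
have -> : X u = xT u by rewrite xTE mu0 scale0r subr0.
by rewrite e1E minkZr minkC => <-; rewrite mulr0.
Unshelve. all: by end_near. Qed.


(** * Christoffel symbols and the geodesic equation *)

Lemma frame_is_derive k u v : U u -> is_derive u v (frame k) ('D_v (frame k) u).
Proof. by move=> Uu; apply: (smooth_is_derive v _ Uu); exact: smooth_derive. Qed.

Lemma frame_commute a b u : U u -> 'D_(e a) (frame b) u = 'D_(e b) (frame a) u.
Proof. by move=> Uu; exact: (smooth_derive_commute (e a) (e b) oU sX Uu). Qed.

Lemma metric_coef_derive u c k l : U u ->
  'D_(e c) (fun x => G x k l) u =
  mink ('D_(e c) (frame k) u) (frame l u) + mink ('D_(e c) (frame l) u) (frame k u).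
Proof.
move=> Uu; have -> : (fun x => G x k l) = fun x => mink (frame k x) (frame l x).
  by apply/funext => x; exact: metric_coefE.
have [_ ->] := is_derive_mink (frame_is_derive k (e c) Uu) (frame_is_derive l (e c) Uu).
by rewrite [mink (frame k u) _]minkC.
Qed.

(** The Gauss formula: each derivative of the metric is a sum of two pairings <D_c X_d, X_m>,
    symmetric in c and d, and in the Christoffel combination all cancel except twice <D_a X_b,
    X_l>. *)
Lemma christoffelE u k a b : U u -> christoffel H i u k a b =
  \sum_l invmx (G u) k l * mink ('D_(e a) (frame b) u) (frame l u).
Proof.
move=> Uu; rewrite /christoffel mulr_sumr; apply: eq_bigr => l _.
have [D [DE Dsym dG]] : exists D : 'I_n -> 'I_n -> 'I_n -> R,
    [/\ forall c d m, mink ('D_(e c) (frame d) u) (frame m u) = D c d m,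
        forall c d m, D c d m = D d c m &
        forall c d m, 'D_(e c) (fun x => G x d m) u = D c d m + D c m d].
  exists (fun c d m => mink ('D_(e c) (frame d) u) (frame m u)).
  split=> c d m; [exact: erefl| |exact (metric_coef_derive c d m Uu)].
  exact (congr1 (fun z => mink z (frame m u)) (frame_commute c d Uu)).
rewrite (DE a b l) (dG a b l) (dG b a l) (dG l a b).
by rewrite (Dsym b a l) (Dsym l a b) (Dsym l b a); field.
Qed.

Lemma christoffel_lower u l a b : U u ->
  \sum_k christoffel H i u k a b * G u k l = mink ('D_(e a) (frame b) u) (frame l u).
Proof.
move=> Uu; pose c : 'cV[R]_n := \col_m mink ('D_(e a) (frame b) u) (frame m u).
transitivity ((G u *m (invmx (G u) *m c)) l 0).
  rewrite mxE; apply: eq_bigr => k _.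
  rewrite christoffelE// mulrC metric_coefE minkC -metric_coefE; congr (_ * _).
  by rewrite mxE; apply: eq_bigr => m _; rewrite [c _ _]mxE.
by rewrite mulKVmx ?metric_coef_unit// mxE.
Qed.

(** Leibniz rule for the expansion of e_1 in the coordinate frame. *)
Lemma unit_accelE u : U u -> unit_accel u =
  \sum_b ('D_(V u) V u 0 b *: frame b u +
           V u 0 b *: \sum_a V u 0 a *: 'D_(e a) (frame b) u).
Proof.
move=> Uu.
have near_e1 : {near u, (fun x => \sum_b (V x 0 b *: frame b x)) =1 (fun x => e1 x)}.
  near=> x; have Ux : U x by near: x; exact: open_nbhs_nbhs.
  by rewrite -unit_coordK// smooth_derive_sum.
rewrite /unit_accel -(near_eq_derive (V u) near_e1).
have D b := is_derive_scale (is_derive_coord b (unit_coord_is_derive (V u) Uu))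
  (frame_is_derive b (V u) Uu).
have -> : (fun x => \sum_b (V x 0 b *: frame b x)) =
    \sum_b (fun x => V x 0 b *: frame b x).
  by apply/funext => x; rewrite fct_sumE.
have [_ ->] := is_derive_sum D; apply: eq_bigr => b _.
by rewrite (smooth_derive_sum _ (smooth_derive _ sX) Uu).
Unshelve. all: by end_near. Qed.

(** The [k]-th coordinate of nabla_V V, the intrinsic acceleration of e_1. *)
Definition geodesic_coef (u : 'rV[R]_n) (k : 'I_n) : R := ('D_(V u) V u) 0 k +
  \sum_a \sum_b christoffel H i u k a b * V u 0 a * V u 0 b.

Lemma mink_unit_accel u l : U u ->
  mink (unit_accel u) (frame l u) = \sum_k geodesic_coef u k * G u k l.
Proof.
move=> Uu; rewrite unit_accelE// mink_suml /geodesic_coef.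
have -> : \sum_k (('D_(V u) V u) 0 k +
      \sum_a \sum_b christoffel H i u k a b * V u 0 a * V u 0 b) * G u k l =
    \sum_k ('D_(V u) V u) 0 k * G u k l + \sum_b \sum_a
      V u 0 b * (V u 0 a * mink ('D_(e a) (frame b) u) (frame l u)).
  under eq_bigr do rewrite mulrDl mulr_suml.
  rewrite big_split/=; congr (_ + _); rewrite exchange_big/= [RHS]exchange_big/=.
  apply: eq_bigr => a _; under eq_bigr do rewrite mulr_suml.
  rewrite exchange_big/=; apply: eq_bigr => b _.
  rewrite -(christoffel_lower l a b Uu) !mulr_sumr; apply: eq_bigr => k _; ring.
rewrite -big_split/=; apply: eq_bigr => b _.
rewrite minkDl !minkZl metric_coefE mink_suml mulr_sumr; congr (_ + _).
by apply: eq_bigr => a _; rewrite minkZl.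
Qed.

(** The pairings with the frame are the intrinsic acceleration with its index lowered, and the
    metric matrix is invertible. *)
Lemma geodesic_coefP u : U u ->
  (forall k, geodesic_coef u k = 0) <-> (forall l, mink (unit_accel u) (frame l u) = 0).
Proof.
move=> Uu; split=> [geo0 l|acc0 k].
  by rewrite mink_unit_accel// big1// => k _; rewrite geo0 mul0r.
suff g0 : (\row_k geodesic_coef u k) *m G u = 0.
  have : \row_k geodesic_coef u k = 0.
    by rewrite -[LHS](mulmxK (metric_coef_unit Uu)) g0 mul0mx.
  by move=> /rowP/(_ k); rewrite !mxE.
apply/rowP => l; rewrite mxE [RHS]mxE; apply: etrans (acc0 l); rewrite mink_unit_accel//.
by apply: eq_bigr => m _; rewrite mxE.
Qed.

End chart.

(** * Change of chart and integral curves *)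

Section charts.
Variables (R : realType) (n : nat) (M : topologicalType).
Variable A : smooth_manifold R n M.
Implicit Types i j : chart_idx A.

Lemma chart_imgP i p : chart_dom i p -> chart_img i (chart i p).
Proof. by move=> ip; exists p. Qed.

Lemma param_dom i u : chart_img i u -> chart_dom i (param i u).
Proof. by move=> [p ip <-]; rewrite chartK. Qed.

Lemma paramK i u : chart_img i u -> chart i (param i u) = u.
Proof. by move=> [p ip <-]; rewrite chartK. Qed.

Lemma near_chart_dom i j u : chart_img i u -> chart_dom j (param i u) ->
  \forall v \near u, chart_dom j (param i v).
Proof.
move=> iu ju; have pc := param_continuous iu.
by apply: pc; apply: open_nbhs_nbhs; split => //; exact: chart_dom_open.
Qed.

Lemma transition_differentiable i j u : chart_img i u -> chart_dom j (param i u) ->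
  differentiable (chart j \o param i) u.
Proof.
move=> iu ju; have [dT _] := transition_smooth i j 1%N.
by apply: dT; exists (param i u); [split=> //; exact: param_dom|exact: paramK].
Qed.

Lemma derive_change_chart (F : M -> 'rV[R]_n.+1) i j u v :
    chart_img i u -> chart_dom j (param i u) ->
    smooth_on (chart_img j) (F \o param j) ->
  'D_v (F \o param i) u =
  'D_('D_v (chart j \o param i) u) (F \o param j) (chart j (param i u)).
Proof.
move=> iu ju sF; have [dF _] := sF 1%N.
rewrite -(@derive_comp _ _ _ _ (chart j \o param i) (F \o param j)).
- apply: near_eq_derive; near=> w => /=; rewrite chartK//.
  by near: w; exact: near_chart_dom.
- exact: transition_differentiable.
- by apply: dF; exact: chart_imgP.
Unshelve. all: by end_near. Qed.

Lemma curve_change_chart i j (c : R -> 'rV[R]_n) t :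
    derivable c t 1 -> chart_img i (c t) -> chart_dom j (param i (c t)) ->
  is_derive t 1 (chart j \o (param i \o c)) ('D_('D_1 c t) (chart j \o param i) (c t)).
Proof.
move=> dc ic jc; apply: (@is_derive_curve _ _ _ (chart j \o param i) c).
  exact: derivableP.
exact: transition_differentiable.
Qed.

End charts.

(** * Integral curves of e_1 and transfer between charts *)

Section integral_curves.
Variables (R : realType) (n : nat) (M : topologicalType).
Variables (A : smooth_manifold R n M) (H : oriented_hypersurface A).
Hypothesis nondeg : nondegenerate_hypersurface H.
Hypothesis xT_neq0 : forall p, tangential_part H p <> 0.
Hypothesis xT_light : forall p, ~ lightlike (tangential_part H p).
Implicit Types i j : chart_idx A.

(** The principal direction may be witnessed in another chart [j], so its coordinate vector is first
    carried to the chart [i], where the immersion property identifies it up to the factor h with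
    [unit_coord]. *)
Lemma normal_rate_of_principal i u : chart_img i u ->
    principal_direction H (param i u) (tangential_part H (param i u)) ->
  exists k, normal_rate H i u = k *: unit_tangential H (param i u).
Proof.
move=> iu [_ [k [j [v [jp xTv Nv]]]]].
have ju : chart_img j (chart j (param i u)) by exact: chart_imgP.
have ij : chart_dom i (param j (chart j (param i u))).
  by rewrite chartK//; exact: param_dom.
move: xTv; rewrite (derive_change_chart _ ju ij (position_smooth H i)).
move: Nv; rewrite (derive_change_chart _ ju ij (normal_smooth H i)).
rewrite chartK// paramK//; set w := 'D_v _ _ => Nw xTw.
have diffX : differentiable (position H \o param i) u.
  by have [dX _] := position_smooth H i 1%N; exact: dX.
have diffN : differentiable (normal H \o param i) u.
  by have [dN _] := normal_smooth H i 1%N; exact: dN.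
have -> : normal_rate H i u = 'D_(unit_coef H i u *: w) (normal H \o param i) u.
  congr ('D__ _ _); apply: (@tangent_coord_uniq _ _ _ _ H i u _ _ iu).
  by rewrite unit_coordK// derive_scaler// -xTw.
exists (- k); rewrite derive_scaler// -Nw e1E.
by rewrite !scalerN scaleNr !scalerA [_ * k]mulrC.
Qed.

Lemma principal_of_normal_rate i u k : chart_img i u ->
    normal_rate H i u = k *: unit_tangential H (param i u) ->
  principal_direction H (param i u) (tangential_part H (param i u)).
Proof.
move=> iu Nk; split; first exact/eqP.
have h0 := unit_coef_neq0 xT_neq0 xT_light i u.
have diffX : differentiable (position H \o param i) u.
  by have [dX _] := position_smooth H i 1%N; exact: dX.
have diffN : differentiable (normal H \o param i) u.
  by have [dN _] := normal_smooth H i 1%N; exact: dN.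
exists (- k), i, ((unit_coef H i u)^-1 *: unit_coord H i u).
rewrite paramK//; split; first exact: param_dom.
  rewrite derive_scaler// unit_coordK// e1E scalerA mulVf//.
  by rewrite scale1r.
have DNk : 'D_(unit_coord H i u) (normal H \o param i) u =
    k *: unit_tangential H (param i u) by [].
rewrite derive_scaler// DNk.
by rewrite e1E !scalerA mulrCA mulVf// mulr1 scaleNr opprK.
Qed.

Lemma integral_curve_chart (J : set R) (gamma : R -> M) i t :
    open J -> integral_curve H (unit_tangential H) J gamma -> J t ->
    chart_dom i (gamma t) ->
  \forall s \near t, chart_img i (chart i (gamma s)) /\
    is_derive s 1 (chart i \o gamma) (unit_coord H i (chart i (gamma s))).
Proof.
move=> oJ int_gamma Jt it; have [cgamma _] := int_gamma t Jt.
have i_near : \forall s \near t, chart_dom i (gamma s).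
  by apply: cgamma; apply: open_nbhs_nbhs; split => //; exact: chart_dom_open.
near=> s; have is_ : chart_dom i (gamma s) by near: s.
have Js : J s by near: s; exact: open_nbhs_nbhs.
have is_img := chart_imgP is_; split => //.
have [_ /(_ i is_)[dc]] := int_gamma s Js.
rewrite derive1E => DX; split => //.
apply: (@tangent_coord_uniq _ _ _ _ H _ _ _ _ is_img).
by rewrite unit_coordK// chartK.
Unshelve. all: by end_near. Qed.

(** Near [t] the velocity of [c] is [unit_coord] along [c], so the chain rule gives the second
    derivative as D_V V and the geodesic expression becomes nabla_V V. *)
Lemma integral_curve_geodesic_coef (J : set R) (gamma : R -> M) i t :
    open J -> integral_curve H (unit_tangential H) J gamma -> J t ->
    chart_dom i (gamma t) ->
  let c : R -> 'rV[R]_n := chart i \o gamma in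
  derivable (derive1 c) t 1 /\ forall k, derive1n 2 c t 0 k + \sum_a \sum_b
      christoffel H i (c t) k a b * derive1 c t 0 a * derive1 c t 0 b
    = geodesic_coef H i (c t) k.
Proof.
move=> oJ int_gamma Jt it c.
have near_c := integral_curve_chart oJ int_gamma Jt it.
have [imgt Dt] := nbhs_singleton near_c.
have c'E : {near t, unit_coord H i \o c =1 derive1 c}.
  by apply: filterS near_c => s [_ [_ Ds]]; rewrite derive1E Ds.
have DV : is_derive t 1 (unit_coord H i \o c)
    ('D_(unit_coord H i (c t)) (unit_coord H i) (c t)).
  apply: is_derive_row => k.
  have [_ <-] := is_derive_coord k
    (unit_coord_is_derive nondeg xT_neq0 xT_light (unit_coord H i (c t)) imgt).
  apply: (is_derive_curve (f := fun x => unit_coord H i x 0 k) Dt).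
  have [dV _] := unit_coord_C1 nondeg xT_neq0 xT_light i k.
  exact: dV.
have [dc' D2] := near_eq_is_derive c'E DV; split => // k.
by rewrite /derive1n/= derive1E D2 -(nbhs_singleton c'E).
Qed.

(** The curve is solved for in the single chart [i]; the chain rule then verifies the equation in
    every chart that meets it. *)
Lemma integral_curve_exists i u : chart_img i u ->
  exists (d : R) (gamma : R -> M), [/\ 0 < d, gamma 0 = param i u &
    integral_curve H (unit_tangential H) `]- d, d[ gamma].
Proof.
move=> iu.
have oU : open (chart_img i) by exact: chart_img_open.
have [r [K [r0 K0 rU lipV]]] :=
  C1_lipschitz oU iu (unit_coord_C1 nondeg xT_neq0 xT_light i).
have [d [c [d0 c0 dc]]] := picard_lindelof r0 K0 lipV.
exists d, (param i \o c); split=> //=; first by rewrite c0.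
move=> t /=; rewrite in_itv/= -ltr_norml => /dc[/rU ic Dc].
have [dct cE] := Dc; have cont_c : {for t, continuous c}.
  exact/differentiable_continuous/derivable1_diffP.
split; first by apply: continuous_comp => //; exact: param_continuous.
move=> j jc /=; have D := curve_change_chart dct ic jc; split; first by have [] := D.
rewrite derive1E; have [_ ->] := D; rewrite cE.
rewrite -(derive_change_chart _ ic jc (position_smooth H j)).
exact: unit_coordK.
Qed.

End integral_curves.

Theorem proposition8 (R : realType) (n : nat) (M : topologicalType)
    (A : smooth_manifold R n M) (H : oriented_hypersurface A)
    (Hnondeg : nondegenerate_hypersurface H)
    (HxT0 : forall p : M, tangential_part H p <> 0)
    (HxTlight : forall p : M, ~ lightlike (tangential_part H p)) :
  GCR H <->
  (forall (J : set R) (gamma : R -> M), open J -> is_interval J ->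
     integral_curve H (unit_tangential H) J gamma -> geodesic H J gamma).
Proof.
split=> [gcr J gamma oJ _ int_gamma t Jt|geo p].
  have [cgamma chart_gamma] := int_gamma t Jt; split=> // i it c.
  have [dc _] := chart_gamma i it.
  have [dc' coefE] :=
    integral_curve_geodesic_coef Hnondeg HxT0 HxTlight oJ int_gamma Jt it.
  split; [exact: dc|exact: dc'|move=> k; apply: etrans (coefE k) _; move: k].
  have imgt := chart_imgP it; apply/(geodesic_coefP Hnondeg HxT0 HxTlight imgt).
  have [k Nk] := normal_rate_of_principal Hnondeg imgt (gcr _).
  exact: geodesic_of_principal Nk.
have [i ip] := chart_cover A p; have imgp := chart_imgP ip; rewrite -(chartK ip).
(* The geodesic equation at time 0 of the integral curve starting at [param i u] is a statement
   about the point [u] alone. *)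
have accel0 u l : chart_img i u -> mink (unit_accel H i u) (frame H i l u) = 0.
  move=> iu; have [d [gamma [d0 gamma0 int_gamma]]] :=
    integral_curve_exists Hnondeg HxT0 HxTlight iu.
  have oJ : open (`]- d, d[%classic : set R) by exact: interval_open.
  have Jo : (`]- d, d[%classic : set R) 0 by rewrite /= in_itv/= oppr_lt0 d0.
  have ig : chart_dom i (gamma 0) by rewrite gamma0; exact: param_dom.
  have [_ coefE] :=
    integral_curve_geodesic_coef Hnondeg HxT0 HxTlight oJ int_gamma Jo ig.
  have [_ /(_ i ig)[_ _ geo0]] := geo _ _ oJ (@interval_is_interval _ _) int_gamma 0 Jo.
  move: l; apply/(geodesic_coefP Hnondeg HxT0 HxTlight iu) => k.
  have <- : chart i (gamma 0) = u by rewrite gamma0 paramK.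
  exact: etrans (esym (coefE k)) (geo0 k).
have [k Nk] := principal_of_geodesic Hnondeg HxT0 HxTlight accel0 imgp.
exact: principal_of_normal_rate Nk.
Qed.
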